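(* Let $n\ge1$ and let $\{\mathbf{s}_1,\dots,\mathbf{s}_M\}\subset\mathbb{R}^n$ be an arbitrary constellation of $M\ge2$ distinct points, used over the AWGN channel with maximum-likelihood detection. Then the second derivative of the symbol error rate in the noise power satisfies, for all $P_N>0$, $$\frac{b_l}{P_N^2}\le\frac{d^2P_e}{dP_N^2}\le\frac{b_u}{P_N^2},$$ where $$b_u=\sqrt{\frac{n+2}{2}}\,\frac{b_1^{n/2}e^{-b_1}}{\Gamma(n/2)},\quad b_l=-\sqrt{\frac{n+2}{2}}\,\frac{b_2^{n/2}e^{-b_2}}{\Gamma(n/2)},\quad b_1=\frac{n+2+\sqrt{2(n+2)}}{2},\quad b_2=\frac{n+2-\sqrt{2(n+2)}}{2},$$ and $\Gamma$ is the gamma function.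
   Context: Setting: a constellation is a set of $M\ge2$ distinct points $\mathbf{s}_1,\dots,\mathbf{s}_M\in\mathbb{R}^n$, normalized by $\frac1M\sum_{i=1}^M|\mathbf{s}_i|^2=1$ ($|\cdot|$ is the Euclidean norm). The received vector is $\mathbf{r}=\mathbf{s}+\boldsymbol{\xi}$, where $\mathbf{s}$ is a random constellation point with prior probabilities $\Pr[\mathbf{s}=\mathbf{s}_i]\ge0$ summing to 1 (not depending on the noise), and $\boldsymbol\xi\sim\mathcal N(\mathbf 0,\sigma_0^2\mathbf I)$ is independent of $\mathbf{s}$. The noise power is $P_N=\sigma_0^2>0$. The maximum-likelihood detector outputs $\hat{\mathbf{s}}=\arg\min_{\mathbf{s}_i}|\mathbf{r}-\mathbf{s}_i|$. The decision region of $\mathbf{s}_i$, with the origin shifted to $\mathbf{s}_i$, is $\Omega_i=\{\mathbf{x}\in\mathbb{R}^n:\ (\mathbf{s}_j-\mathbf{s}_i)^T\mathbf{x}\le\frac12|\mathbf{s}_j-\mathbf{s}_i|^2\ \ \forall j\ne i\}$. $P_{ci}(P_N)=\int_{\Omega_i}(2\pi P_N)^{-n/2}e^{-|\mathbf{x}|^2/(2P_N)}\,d\mathbf{x}$, $P_{ei}=1-P_{ci}$, $P_e=\sum_{i=1}^M P_{ei}\Pr[\mathbf{s}=\mathbf{s}_i]$. *)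

(* Defs.v *)
From HB Require Import structures.
From mathcomp Require Import all_boot all_order all_algebra.
From mathcomp Require Import all_classical all_reals all_analysis.

Set Implicit Arguments.
Unset Strict Implicit.
Unset Printing Implicit Defensive.

Import Order.TTheory GRing.Theory Num.Theory.
Import numFieldNormedType.Exports.

Local Open Scope classical_set_scope.
Local Open Scope ring_scope.

Section lebesgue_Rn.
Context {R : realType}.
Local Notation mR := (measurableTypeR R).

Definition tuple_pair n (x : mR * n.-tuple mR) : n.+1.-tuple mR :=
  [tuple of x.1 :: x.2].

Lemma measurable_tuple_pair n : measurable_fun setT (@tuple_pair n).
Proof. exact: measurable_cons. Qed.

Definition lebesgue_step n
    (mu : {sigma_finite_measure set (n.-tuple mR) -> \bar R}) :=
  pushforward (@lebesgue_measure R \x mu)%E (@tuple_pair n).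

Section step.
Context n (mu : {sigma_finite_measure set (n.-tuple mR) -> \bar R}).

Let lebesgue_step0 : lebesgue_step mu set0 = 0%E.
Proof. by rewrite /lebesgue_step /pushforward preimage_set0 measure0. Qed.

Let lebesgue_step_ge0 A : (0 <= lebesgue_step mu A)%E.
Proof. by rewrite /lebesgue_step /pushforward measure_ge0. Qed.

Let lebesgue_step_sigma_additive : semi_sigma_additive (lebesgue_step mu).
Proof.
have mf := @measurable_tuple_pair n.
move=> F mF tF mUF; rewrite /lebesgue_step /pushforward preimage_bigcup.
apply: measure_semi_sigma_additive.
- by move=> k; rewrite -[X in measurable X]setTI; exact: mf.
- apply/trivIsetP => /= i j _ _ ij; rewrite -preimage_setI.
  by move/trivIsetP : tF => /(_ _ _ _ _ ij) ->//; rewrite preimage_set0.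
- by rewrite -preimage_bigcup -[X in measurable X]setTI; exact: mf.
Qed.

HB.instance Definition _ := isMeasure.Build _ _ _ (lebesgue_step mu)
  lebesgue_step0 lebesgue_step_ge0 lebesgue_step_sigma_additive.

Lemma lebesgue_step_sigma_finite : sigma_finite setT (lebesgue_step mu).
Proof.
have /sigma_finiteP[F [TF ndF Foo]] := sigma_finiteT (@lebesgue_measure R).
have /sigma_finiteP[G [TG ndG Goo]] := sigma_finiteT mu.
pose f (t : n.+1.-tuple mR) : mR * n.-tuple mR :=
  (tnth t ord0, [tuple of behead t]).
have mf : measurable_fun setT f.
  apply/measurable_fun_pair; first exact: measurable_tnth.
  exact: measurable_behead.
exists (fun k => f @^-1` (F k `*` G k)).
  rewrite -preimage_bigcup -(preimage_setT f); congr (f @^-1` _).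
  rewrite -setXTT TF TG predeqE => -[x y]; split.
    move=> [/= [k _ Fkx] [l _ Gly]]; exists (maxn k l) => //; split.
    - by move: x Fkx; exact/subsetPset/ndF/leq_maxl.
    - by move: y Gly; exact/subsetPset/ndG/leq_maxr.
  by move=> [k _ []/= ? ?]; split; exists k.
move=> k; have [? ?] := Foo k; have [? ?] := Goo k; split.
  rewrite -[X in measurable X]setTI; apply: mf => //; exact: measurableX.
rewrite /lebesgue_step /pushforward -comp_preimage.
have -> : f \o @tuple_pair n = id.
  by apply/funext => -[x t]; rewrite /f /tuple_pair/=; congr pair; exact/val_inj.
by rewrite preimage_id product_measure1E// lte_mul_pinfty// ge0_fin_numE.
Qed.

HB.instance Definition _ := Measure_isSigmaFinite.Build _ _ _
  (lebesgue_step mu) lebesgue_step_sigma_finite.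

End step.

(* Lebesgue measure on R^n, with the product sigma-algebra of n.-tuple mR:
   the point mass in dimension 0, and in dimension n.+1 the product of
   one-dimensional Lebesgue measure with the n-dimensional one, carried along
   (x, t) |-> x :: t. *)
Fixpoint lebesgue_Rn n : {sigma_finite_measure set (n.-tuple mR) -> \bar R} :=
  match n return {sigma_finite_measure set (n.-tuple mR) -> \bar R} with
  | 0%N => (\d_([tuple] : 0.-tuple mR) : {sigma_finite_measure set _ -> \bar R})
  | m.+1 => (lebesgue_step (lebesgue_Rn m)
              : {sigma_finite_measure set _ -> \bar R})
  end.

Lemma lebesgue_Rn_box n (A : 'I_n -> set mR) :
  (forall i, measurable (A i)) ->
  lebesgue_Rn n [set t | forall i, A i (tnth t i)] =
  (\prod_(i < n) lebesgue_measure (A i))%E.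
Proof.
elim: n A => [|n IHn] A mA.
  rewrite big_ord0 /= diracE mem_set//=; by case.
have mB : measurable [set t : n.-tuple mR | forall i, A (lift ord0 i) (tnth t i)].
  rewrite (_ : [set _ | _] = \bigcap_(i in [set: 'I_n])
      ((@tnth n mR)^~ i @^-1` A (lift ord0 i))).
    apply: fin_bigcap_measurable => // i _.
    by rewrite -[X in measurable X]setTI; exact: measurable_tnth.
  by apply/seteqP; split => t /= At i => [_|]; exact: At.
rewrite big_ord_recl -IHn; last by move=> i; exact: mA.
rewrite -product_measure1E//= /lebesgue_step /pushforward; congr (_ _).
apply/seteqP; split => -[x t] /=.
  move=> At; split; first exact: (At ord0).
  by move=> i; have := At (lift ord0 i); rewrite tnthS.
by move=> [Ax At] i; case: (unliftP ord0 i) => [j|] ->; rewrite ?tnthS.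
Qed.

End lebesgue_Rn.

Section defs.
Context {R : realType}.

Definition col_of_tuple n (t : n.-tuple (measurableTypeR R)) : 'cV[R]_n := \col_i tnth t i.

(* Euclidean norm; the library norm `|x| on matrices is the sup norm. *)
Definition enorm n (x : 'cV[R]_n) : R := Num.sqrt ((x^T *m x) 0 0).

Definition Gamma (a : R) : R :=
  (\int[lebesgue_measure]_(t in `]0, +oo[) (t `^ (a - 1) * expR (- t)))%R.

Definition constellation M n (s : 'I_M -> 'cV[R]_n) :=
  injective s /\ M%:R^-1 * \sum_(i < M) enorm (s i) ^+ 2 = 1.

Definition priors M (p : 'I_M -> R) :=
  (forall i, 0 <= p i) /\ \sum_(i < M) p i = 1.

Section error_rate.
Context (M n : nat) (s : 'I_M -> 'cV[R]_n).

(* Maximum-likelihood decision region of s i, with the origin moved to s i. *)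
Definition decision_region (i : 'I_M) : set 'cV[R]_n :=
  [set x | forall j, j != i ->
     ((s j - s i)^T *m x) 0 0 <= 2^-1 * enorm (s j - s i) ^+ 2].

Definition noise_density (PN : R) (x : 'cV[R]_n) : R :=
  (2 * pi * PN) `^ (- (n%:R / 2)) * expR (- (enorm x ^+ 2 / (2 * PN))).

(* Integrals over R^n are taken in the coordinates t of x. *)
Definition Pc (i : 'I_M) (PN : R) : R :=
  (\int[lebesgue_Rn n]_(t in @col_of_tuple n @^-1` decision_region i)
     noise_density PN (col_of_tuple t))%R.

Definition Pei (i : 'I_M) (PN : R) : R := 1 - Pc i PN.

(* Symbol error rate with priors p, as a function of the noise power. *)
Definition Pe (p : 'I_M -> R) (PN : R) : R := \sum_(i < M) Pei i PN * p i.

End error_rate.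

Definition b1 n : R := (n%:R + 2 + Num.sqrt (2 * (n%:R + 2))) / 2.

Definition b2 n : R := (n%:R + 2 - Num.sqrt (2 * (n%:R + 2))) / 2.

Definition bu n : R :=
  Num.sqrt ((n%:R + 2) / 2) *
  (b1 n `^ (n%:R / 2) * expR (- b1 n) / Gamma (n%:R / 2)).

Definition bl n : R :=
  - (Num.sqrt ((n%:R + 2) / 2) *
     (b2 n `^ (n%:R / 2) * expR (- b2 n) / Gamma (n%:R / 2))).

End defs.

(* Main.v *)
(** Write [u = |x|^2 / (2 P)] and [a = n / 2]. A decision region is star-shaped
    about the origin: it is cut out of each ray by a threshold on [u] of the
    form [u <= 1 / (z P)], where [z >= 0] depends on the direction only.
    Integrating radially first, [Pc] is therefore an average over directions of
    [Phi (1 / (z P)) / Gamma a], with [Phi u] the integral of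
    [t^(a-1) e^-t] over [0, u]. Two derivatives in [P] turn the integrand into
    [g (1 / (z P)) / (P^2 Gamma a)], where [g u = u^a e^-u (a + 1 - u)], and the
    extreme values of [g] on [0, +oo[ are attained at [b1] and [b2].

    No polar coordinates are needed: for [h >= 0], Tonelli's theorem and the
    behaviour of Lebesgue measure under dilations show that the integral of
    [t^(a-1) |y|^n e^(-|y|^2) h (sqrt t y)] over [t > 0] and [y] in R^n is the
    integral of [h] times a constant, which is [Gamma a] because a Gaussian
    density integrates to 1. *)

Require Import Defs.
From mathcomp Require Import all_boot all_order all_algebra.
From mathcomp Require Import all_classical all_reals all_analysis.
From mathcomp Require Import ring measurable_realfun.
Import Order.TTheory GRing.Theory Num.Theory.
Import numFieldNormedType.Exports.
Local Open Scope ring_scope.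
Local Open Scope classical_set_scope.

(** * The functions [u^a e^-u] and [u^a e^-u (a + 1 - u)] *)

Section peak.
Local Open Scope ring_scope.
Context {R : realType}.
Implicit Types a u : R.

Definition gamma_peak a u : R := u `^ a * expR (- u).

Lemma gamma_peak_ge0 a u : 0 <= gamma_peak a u.
Proof. by rewrite mulr_ge0 ?powR_ge0 ?expR_ge0. Qed.

(* [1 + x <= expR x] at both factors is tight at [u = b], and the exponents
   cancel because [b] is a critical point. *)
Lemma gamma_peak_affine_le a b d u : 0 < a -> 0 < b -> d != 0 ->
  a / b = 1 + d^-1 -> 0 <= u -> 0 <= (d + b - u) / d ->
  gamma_peak a u * ((d + b - u) / d) <= gamma_peak a b.
Proof.
move=> a0 b0 d0 crit u0 hd.
have bN0 : b != 0 by rewrite gt_eqF.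
have h1 : u `^ a <= b `^ a * expR (a * (u / b - 1)).
  have {1}-> : u = b * (u / b) by field.
  rewrite powRM ?divr_ge0 ?(ltW b0)//.
  rewrite ler_wpM2l ?powR_ge0// (mulrC a) expRM.
  apply: ge0_ler_powR; rewrite ?(ltW a0)// ?nnegrE ?expR_ge0 ?divr_ge0 ?(ltW b0)//.
  by apply: le_trans (expR_ge1Dx _); rewrite addrC subrK.
have h2 : (d + b - u) / d <= expR ((b - u) / d).
  apply: le_trans (expR_ge1Dx _).
  by rewrite -addrA mulrDl divff.
rewrite /gamma_peak mulrAC.
apply: (@le_trans _ _ (b `^ a * expR (a * (u / b - 1)) * expR ((b - u) / d) *
    expR (- u))).
  by rewrite ler_wpM2r ?expR_ge0// ler_pM ?powR_ge0.
rewrite -!mulrA -!expRD ler_wpM2l ?powR_ge0// ler_expR.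
have -> : a * (u / b - 1) = (a / b) * (u - b) by field.
rewrite crit le_eqVlt; apply/orP; left; apply/eqP; field.
exact: d0.
Qed.

(** Raise [1 + x <= expR x] at [x = u / a - 1] to the power [a]. The bound makes the first
    [P]-derivative uniformly bounded in the direction, and it also supplies the constant that
    dominates the gamma density. *)
Lemma gamma_peak_le a u : 0 < a -> 0 <= u -> gamma_peak a u <= gamma_peak a a.
Proof.
move=> a0 u0.
have aN0 : a != 0 by rewrite gt_eqF.
rewrite /gamma_peak.
have h1 : u `^ a <= a `^ a * expR (u - a).
  have {1}-> : u = a * (u / a) by field.
  rewrite powRM ?divr_ge0 ?(ltW a0)//.
  have -> : u - a = (u / a - 1) * a by field.
  rewrite ler_wpM2l ?powR_ge0// expRM.
  apply: ge0_ler_powR; rewrite ?(ltW a0)// ?nnegrE ?expR_ge0 ?divr_ge0 ?(ltW a0)//.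
  by apply: le_trans (expR_ge1Dx _); rewrite addrC subrK.
apply: (le_trans (ler_wpM2r (expR_ge0 _) h1)).
by rewrite -mulrA -expRD (_ : u - a - u = - a)//; ring.
Qed.

Lemma gamma_peak0 a : 0 < a -> gamma_peak a 0 = 0.
Proof. by move=> a0; rewrite /gamma_peak powR0 ?gt_eqF// mul0r. Qed.

Lemma is_derive_gamma_peak a u : 0 < u ->
  is_derive u 1 (gamma_peak a) (gamma_peak a u * (a / u - 1)).
Proof.
move=> u0.
have uN0 : u != 0 by rewrite gt_eqF.
have d1 := is_derive1_powR a u0.
have d2 : is_derive u 1 (fun x : R => expR (- x)) (- expR (- u)).
  have := @is_derive1_comp R expR (-%R) u _ _ (is_derive_expR (- u)) (is_deriveNid _ _).
  by rewrite mulrN1.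
have h : is_derive u 1 (gamma_peak a) _ := is_deriveM d1 d2.
apply: is_derive_eq h _.
rewrite /gamma_peak /= /GRing.scale /= powRB ?uN0 ?implybT// powRr1 ?ltW//.
by field.
Qed.

End peak.

(** * The truncated gamma integral *)

Section gamma_density.
Local Open Scope ring_scope.
Context {R : realType}.
Implicit Types a t u x : R.
Local Notation leb := (@lebesgue_measure R).

(** On compact intervals exhausting ]0, +oo[ the integral of [f] is a difference of two values of
    [F], hence at most [M]; monotone convergence passes to the limit. *)
Lemma integrable_derive_bounded (F f : R -> R) (M : R) :
  (forall x, 0 < x -> is_derive x 1 F (f x)) ->
  (forall x, 0 < x -> {for x, continuous f}) ->
  (forall x, 0 < x -> 0 <= f x) ->
  (forall x, 0 < x -> 0 <= F x <= M) ->
  leb.-integrable `](0 : R), +oo[ (EFin \o f).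
Proof.
move=> dF cf f0 FM.
have mf : measurable_fun `](0 : R), +oo[ f.
  apply: open_continuous_measurable_fun => // x.
  by rewrite inE/= in_itv/= andbT => /cf.
apply/integrableP; split; first exact/measurable_EFinP.
under eq_integral => x.
  rewrite inE/= in_itv/= andbT => x0; rewrite ger0_norm ?f0//.
  over.
(* The right end [k.+2] keeps the interval nondegenerate at [k = 0], as the fundamental theorem of
   calculus requires. *)
pose I (k : nat) : set R := `[k.+1%:R^-1, k.+2%:R]%classic.
have I0 k x : I k x -> 0 < x.
  by rewrite /I/= in_itv/= => /andP[kx _]; apply: lt_le_trans kx; rewrite invr_gt0.
have -> : `]0, +oo[%classic = \bigcup_k I k.
  apply/seteqP; split => [x|x [k _ /I0]]; last by rewrite /= in_itv/= andbT.
  rewrite /= in_itv/= andbT => x0.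
  exists (maxn (Num.trunc x^-1) (Num.trunc x)) => //=; rewrite /I /= in_itv/=.
  apply/andP; split.
    rewrite invf_ple ?posrE ?invr_gt0//.
    apply: (@le_trans _ _ (Num.trunc x^-1).+1%:R); first exact/ltW/truncnS_gt.
    by rewrite ler_nat ltnS leq_maxl.
  apply: (@le_trans _ _ (Num.trunc x).+1%:R); first exact/ltW/truncnS_gt.
  by rewrite ler_nat ltnS leqW// leq_maxr.
have ndI : nondecreasing_seq I.
  move=> i j ij; apply/subsetPset => x; rewrite /I/= !in_itv/= => /andP[h1 h2].
  apply/andP; split; first by apply: le_trans h1; rewrite lef_pV2 ?posrE// ler_nat ltnS.
  by apply: le_trans h2 _; rewrite ler_nat !ltnS.
have mI k : measurable (I k : set (measurableTypeR R)) by exact: measurable_itv.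
have mfI k : measurable_fun (I k) (EFin \o f).
  apply/measurable_EFinP; apply: measurable_funS mf => //.
  by move=> x /I0; rewrite /= in_itv/= andbT.
have fI0 k x : I k x -> (0 <= (EFin \o f) x)%E by move=> /I0 /f0; rewrite lee_fin.
have := @ge0_nondecreasing_set_cvg_integral _ (measurableTypeR R) R I
  (EFin \o f) leb ndI mI mfI fI0.
move=> /cvg_lim <-//.
apply: (@le_lt_trans _ _ M%:E); last exact: ltry.
apply: lime_le.
  apply: ereal_nondecreasing_is_cvgn.
  exact: (@ge0_nondecreasing_set_nondecreasing_integral _ (measurableTypeR R) R I
    (EFin \o f) leb).
apply: nearW => k.
have lk : k.+1%:R^-1 < k.+2%:R :> R.
  by rewrite (@le_lt_trans _ _ 1)// ?invf_le1// ?ler1n// ltr1n.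
have posk (x : R) : x \in `[k.+1%:R^-1, k.+2%:R] -> 0 < x.
  by move=> xk; apply: (I0 k); exact: xk.
rewrite (@continuous_FTC2 _ f F)//; first last.
- move=> x xk; rewrite derive1E; apply: (@derive_val _ _ _ _ _ _ _ (dF _ _)).
  exact/posk/subset_itv_oo_cc.
- have cF x : 0 < x -> {for x, continuous F}.
    move=> x0; apply/differentiable_continuous/derivable1_diffP.
    exact: (@ex_derive _ _ _ _ _ _ _ (dF x x0)).
  split.
  + move=> x xk; apply: (@ex_derive _ _ _ _ _ _ _ (dF _ _)).
    exact/posk/subset_itv_oo_cc.
  + by apply: cvg_at_right_filter; apply: cF; rewrite invr_gt0.
  + by apply: cvg_at_left_filter; apply: cF.
- apply: continuous_in_subspaceT => x; rewrite inE => xk.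
  exact/cf/posk.
rewrite -EFinB lee_fin.
have /andP[_ h1] := FM k.+2%:R ltac:(done).
have /andP[h2 _] := FM k.+1%:R^-1 ltac:(by rewrite invr_gt0).
by rewrite lerBlDr (le_trans h1)// lerDl.
Qed.

Definition gamma_density a t : R := t `^ (a - 1) * expR (- t).

Lemma gamma_density_ge0 a t : 0 <= gamma_density a t.
Proof. by rewrite mulr_ge0 ?powR_ge0 ?expR_ge0. Qed.

Lemma measurable_gamma_density a D : measurable_fun D (gamma_density a).
Proof.
apply: measurable_funTS; apply: measurable_funM; first exact: measurable_powR.
by apply: measurableT_comp => //; exact: measurable_funN.
Qed.

Lemma continuous_gamma_density a x : 0 < x -> {for x, continuous (gamma_density a)}.
Proof.
move=> x0.
have := is_derive_gamma_peak (a - 1) x x0.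
by move=> [h _]; apply/differentiable_continuous/derivable1_diffP.
Qed.

(* Up to a constant, the derivative of [(t / (1 + t)) `^ a] dominates. *)
Lemma integrable_gamma_density a : 0 < a ->
  leb.-integrable `](0 : R), +oo[ (EFin \o gamma_density a).
Proof.
move=> a0.
pose r t : R := t / (1 + t).
pose F t := r t `^ a.
pose f t := a * r t `^ (a - 1) * (1 + t) ^- 2.
have r0 x : 0 < x -> 0 < r x by move=> x0; rewrite divr_gt0// addr_gt0.
have dr x : 0 < x -> is_derive x 1 r ((1 + x) ^- 2).
  move=> x0; have x1 : 1 + x != 0 by rewrite gt_eqF// addr_gt0.
  have d1 : is_derive x 1 (fun y : R => 1 + y) 1.
    have h : is_derive x 1 (fun y : R => 1 + y) _ :=
      is_deriveD (is_derive_cst (1 : R) x 1) (is_derive_id x 1).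
    by apply: is_derive_eq h _; rewrite add0r.
  have h : is_derive x 1 r _ := is_deriveM (is_derive_id x 1) (is_deriveV x1 d1).
  by apply: is_derive_eq h _; rewrite /GRing.scale/=; field.
have dF x : 0 < x -> is_derive x 1 F (f x).
  move=> x0.
  have h : is_derive x 1 F _ := is_derive1_comp (is_derive1_powR a (r0 x x0)) (dr x x0).
  exact: h.
have cdv (G : R -> R) (x g : R) : is_derive x 1 G g -> {for x, continuous G}.
  by move=> [h _]; apply/differentiable_continuous/derivable1_diffP.
have cf x : 0 < x -> {for x, continuous f}.
  move=> x0; have x1 : 1 + x != 0 by rewrite gt_eqF// addr_gt0.
  rewrite /f; apply: cvgM.
    apply: cvgM; first exact: cvg_cst.
    have h : is_derive x 1 (fun t => r t `^ (a - 1)) _ :=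
      is_derive1_comp (is_derive1_powR (a - 1) (r0 x x0)) (dr x x0).
    exact: cdv h.
  apply: cvgV; first by rewrite expf_neq0.
  have c1 : {for x, continuous (fun t : R => 1 + t)}.
    by apply: cvgD; [exact: cvg_cst|exact: cvg_id].
  exact: (cvgM c1 c1).
have intf : leb.-integrable `](0 : R), +oo[ (EFin \o f).
  apply: (@integrable_derive_bounded F f 1) => //.
    by move=> x x0; rewrite /f !mulr_ge0 ?powR_ge0 ?ltW// invr_gt0 exprn_gt0// addr_gt0.
  move=> x x0; rewrite /F powR_ge0/=.
  apply: (@le_trans _ _ (1 `^ a)); last by rewrite powR1.
  rewrite ge0_ler_powR ?(ltW a0) ?nnegrE ?(ltW (r0 _ x0))//.
  by rewrite /r ler_pdivrMr ?addr_gt0// mul1r lerDr.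
(* Here [f x = a x^(a-1) (1 + x)^-(a+1)], so the claim reduces to a bound on [(1 + x)^(a+1) e^-x],
   which is [e] times [gamma_peak (a + 1) (1 + x)] and hence at most [e] times the peak value at
   [a + 1]. *)
pose C := expR 1 * gamma_peak (a + 1) (a + 1) / a.
apply: (@le_integrable _ _ _ leb `](0 : R), +oo[ _ _
  (fun x => C%:E * (EFin \o f) x)%E) => //.
- by apply/measurable_EFinP; apply: measurable_gamma_density.
- move=> x; rewrite /= in_itv/= andbT => x0.
  have x1 : 0 < 1 + x by rewrite addr_gt0.
  rewrite lee_fin ger0_norm ?gamma_density_ge0//.
  apply: le_trans (ler_norm _).
  have peak := gamma_peak_le (a + 1) (1 + x) (addr_gt0 a0 ltr01) (ltW x1).
  rewrite /C /f /gamma_density.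
  have -> : r x `^ (a - 1) = x `^ (a - 1) / (1 + x) `^ (a - 1).
    rewrite /r powRM ?invr_ge0 ?(ltW x0) ?(ltW x1)//.
    by rewrite -powR_inv1 ?(ltW x1)// -powRrM mulN1r powRN.
  have -> : (1 + x) `^ (a - 1) = (1 + x) `^ (a + 1) / (1 + x) ^+ 2.
    have -> : a - 1 = a + 1 - 2%:R by ring.
    by rewrite powRB ?(gt_eqF x1) ?implybT// (powR_mulrn 2%N (ltW x1)).
  have y0 : 0 < (1 + x) `^ (a + 1) by rewrite powR_gt0.
  have p0 : 0 <= x `^ (a - 1) by rewrite powR_ge0.
  have -> : expR 1 * gamma_peak (a + 1) (a + 1) / a *
     (a * (x `^ (a - 1) / ((1 + x) `^ (a + 1) / (1 + x) ^+ 2)) / (1 + x) ^+ 2) =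
     x `^ (a - 1) * (expR 1 * gamma_peak (a + 1) (a + 1) / (1 + x) `^ (a + 1)).
    by field; rewrite !gt_eqF.
  rewrite ler_wpM2l// ler_pdivlMr// mulrC.
  have -> : (1 + x) `^ (a + 1) * expR (- x) = expR 1 * gamma_peak (a + 1) (1 + x).
    rewrite /gamma_peak mulrCA -expRD; congr (_ * expR _); ring.
  by rewrite ler_wpM2l ?expR_ge0.
- exact: integrableZl.
Qed.

End gamma_density.

Section truncated_gamma.
Local Open Scope ring_scope.
Context {R : realType}.
Implicit Types a t u v x z P : R.
Local Notation leb := (@lebesgue_measure R).

(* The integral over ]0, v^-1] for [v > 0], and [Gamma a] for [v <= 0]. *)
Definition truncated_gamma a v : R :=
  \int[leb]_(t in `]0, +oo[ `&` [set t | t * v <= 1]) gamma_density a t.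

Lemma measurable_truncation v :
  measurable (`]0, +oo[ `&` [set t | t * v <= 1] : set (measurableTypeR R)).
Proof.
apply: measurableI => //.
rewrite (_ : [set _ | _] = setT `&` (fun t => t * v) @^-1` `]-oo, 1]); last first.
  by rewrite setTI; apply/seteqP; split => t; rewrite /= in_itv.
have mf : measurable_fun setT (fun t : R => t * v) by exact: measurable_funM.
exact: mf.
Qed.

Lemma integrable_truncation a v : 0 < a ->
  leb.-integrable (`]0, +oo[ `&` [set t | t * v <= 1]) (EFin \o gamma_density a).
Proof.
move=> a0; apply: (@integrableS _ (measurableTypeR R) R leb `]0, +oo[) => //.
- exact: measurable_truncation.
- exact: integrable_gamma_density.
Qed.

Lemma truncated_gamma_le a : 0 < a -> nonincreasing_fun (truncated_gamma a).
Proof.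
move=> a0 v w vw.
rewrite /truncated_gamma /Rintegral fine_le//.
- apply: (@integrable_fin_num _ (measurableTypeR R)).
    exact: measurable_truncation.
  exact: integrable_truncation.
- apply: (@integrable_fin_num _ (measurableTypeR R)).
    exact: measurable_truncation.
  exact: integrable_truncation.
- apply: (@ge0_subset_integral _ (measurableTypeR R)).
  + exact: measurable_truncation.
  + exact: measurable_truncation.
  + by apply/measurable_EFinP; apply: measurable_gamma_density.
  + by move=> x _; rewrite lee_fin gamma_density_ge0.
  + move=> t [/= t0 tw]; split => //=; apply: le_trans tw.
    by move: t0; rewrite in_itv/= andbT => t0; rewrite ler_wpM2l// ltW.
Qed.

Lemma truncated_gamma_ge0 a v : 0 <= truncated_gamma a v.
Proof. by apply: Rintegral_ge0 => t _; exact: gamma_density_ge0. Qed.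

Lemma truncated_gamma0 a : truncated_gamma a 0 = Gamma a.
Proof.
by rewrite /truncated_gamma setIidl// => t _ /=; rewrite mulr0.
Qed.

Lemma truncated_gamma_pos a v : 0 < v ->
  truncated_gamma a v = \int[leb]_(t in `]0, v^-1]) gamma_density a t.
Proof.
move=> v0; rewrite /truncated_gamma.
rewrite [X in Rintegral _ X](_ : _ = `]0, v^-1]%classic)//.
apply/seteqP; split => t /=; rewrite !in_itv/= ?andbT.
  by move=> [-> h]; rewrite -[leRHS]mul1r ler_pdivlMr.
by move=> /andP[-> h]; split => //; rewrite -ler_pdivlMr// mul1r.
Qed.

(** The fundamental theorem of calculus, composed with inversion: the factor [- v^-2] turns the
    density at [v^-1] into the peak function divided by [v]. *)
Lemma is_derive_truncated_gamma a v : 0 < a -> 0 < v ->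
  is_derive v 1 (truncated_gamma a) (- (gamma_peak a v^-1 / v)).
Proof.
move=> a0 v0.
pose N x : R := \int[leb]_(t in `]0, x]) gamma_density a t.
have vV0 : 0 < v^-1 by rewrite invr_gt0.
have vN0 : v != 0 by rewrite gt_eqF.
(* Integrability is supplied up to [v^-1 + 1], so that [v^-1] is not an endpoint. *)
have [dN NE] := @continuous_FTC1 R (gamma_density a) (BRight 0) v^-1 (v^-1 + 1)
  (ltr_pwDr ltr01 (lexx _))
  (@integrableS _ (measurableTypeR R) R leb _ _ _ (measurable_itv _) (measurable_itv _)
     (@subset_itvl _ _ (BRight 0) (BRight (v^-1 + 1)) +oo%O isT)
     (integrable_gamma_density _ a0)) vV0 (continuous_gamma_density _ _ vV0).
have hN : is_derive v^-1 1 N (gamma_density a v^-1).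
  by split; [exact: dN|rewrite -derive1E; exact: NE].
have h : is_derive v 1 (N \o (@GRing.inv R)) _ :=
  is_derive1_comp hN (is_deriveV vN0 (is_derive_id v 1)).
have e : is_derive v 1 (N \o (@GRing.inv R)) (- (gamma_peak a v^-1 / v)).
  apply: is_derive_eq h _.
  rewrite /gamma_density /gamma_peak /GRing.scale/= powRB ?invr_eq0 ?vN0 ?implybT//.
  by rewrite powRr1 ?ltW//; field.
apply: near_eq_is_derive e; near=> x.
rewrite truncated_gamma_pos//; near: x; exact: lt_nbhsr.
Unshelve. all: end_near. Qed.

(* Since [0^-1 = 0] and [gamma_peak a 0 = 0], the formula also covers [z = 0]. *)
Lemma is_derive_truncated_gammaM a z P : 0 < a -> 0 <= z -> 0 < P ->
  is_derive P 1 (fun Q => truncated_gamma a (z * Q))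
    (- (gamma_peak a (z * P)^-1 / P)).
Proof.
move=> a0; rewrite le_eqVlt => /predU1P[<-|z0] P0.
  under eq_fun do rewrite mul0r.
  rewrite mul0r invr0 gamma_peak0// mul0r oppr0; exact: is_derive_cst.
have zP0 : 0 < z * P by rewrite mulr_gt0.
have h : is_derive P 1 (fun Q => truncated_gamma a (z * Q)) _ :=
  is_derive1_comp (is_derive_truncated_gamma a (z * P) a0 zP0)
    (is_deriveZ z (is_derive_id P 1)).
by apply: is_derive_eq h _; rewrite /GRing.scale/=; field; rewrite !gt_eqF.
Qed.

(** With [u = (z P)^-1] one has [du/dP = - u / P], so differentiating the peak contributes [a - u]
    and differentiating [1 / P] contributes the extra [1]. The case [z = 0] is constant by the
    convention [0^-1 = 0]. *)
Lemma is_derive_gamma_peakM a z P : 0 < a -> 0 <= z -> 0 < P ->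
  is_derive P 1 (fun Q => - (gamma_peak a (z * Q)^-1 / Q))
    (gamma_peak a (z * P)^-1 * (a + 1 - (z * P)^-1) / P ^+ 2).
Proof.
move=> a0 + P0; have PN0 : P != 0 by rewrite gt_eqF.
rewrite le_eqVlt => /predU1P[<-|z0].
  under eq_fun do rewrite mul0r invr0 gamma_peak0// mul0r oppr0.
  rewrite mul0r invr0 gamma_peak0// !mul0r; exact: is_derive_cst.
have zP0 : 0 < z * P by rewrite mulr_gt0.
have dV : is_derive P 1 (fun Q => (z * Q)^-1) _ :=
  is_deriveV (lt0r_neq0 zP0) (is_deriveZ z (is_derive_id P 1)).
have VzP0 : 0 < (z * P)^-1 by rewrite invr_gt0.
have dp : is_derive P 1 (fun Q => gamma_peak a (z * Q)^-1) _ :=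
  @is_derive1_comp R (gamma_peak a) (fun Q => (z * Q)^-1) P _ _
    (is_derive_gamma_peak a (z * P)^-1 VzP0) dV.
have h : is_derive P 1 (fun Q => - (gamma_peak a (z * Q)^-1 / Q)) _ :=
  is_deriveN (is_deriveM dp (is_deriveV PN0 (is_derive_id P 1))).
by apply: is_derive_eq h _; rewrite /GRing.scale/=; field; rewrite PN0 gt_eqF.
Qed.

End truncated_gamma.

(** * Differentiation of mixtures of truncated gamma integrals *)

Section second_order_peak.
Local Open Scope ring_scope.
Context {R : realType}.
Implicit Types a u : R.

(** The critical points of the left side on u > 0 solve [(u - (a + 1))^2 = a + 1]. The smaller one
    is [b = a + 1 - s = s (s - 1)], where [a / b = (s + 1) / s]; this is the hypothesis of
    [gamma_peak_affine_le] with [d = s]. Past [u = a + 1] the left side is not positive. *)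
Lemma second_order_peak_ub a u : 0 < a -> 0 <= u ->
  gamma_peak a u * (a + 1 - u) <=
  Num.sqrt (a + 1) * gamma_peak a (a + 1 - Num.sqrt (a + 1)).
Proof.
move=> a0 u0; set s := Num.sqrt (a + 1).
have sE : s ^+ 2 = a + 1 by rewrite sqr_sqrtr// addr_ge0// ltW.
have s1 : 1 < s by rewrite -sqrtr1 ltr_sqrt ?ltrDr// addr_gt0.
have s0 : 0 < s by rewrite (lt_trans _ s1).
have bE : a + 1 - s = s * (s - 1) by rewrite -sE; ring.
have [h|h] := leP (a + 1 - u) 0.
  apply: (@le_trans _ _ 0); first by rewrite mulr_ge0_le0// gamma_peak_ge0.
  by rewrite mulr_ge0 ?gamma_peak_ge0// ltW.
have sN0 : s != 0 by rewrite gt_eqF.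
have s1N0 : s - 1 != 0 by rewrite subr_eq0 gt_eqF.
have -> : gamma_peak a u * (a + 1 - u) =
    s * (gamma_peak a u * ((s + (a + 1 - s) - u) / s)) by field.
rewrite ler_wpM2l ?(ltW s0)//; apply: gamma_peak_affine_le => //.
- by rewrite bE mulr_gt0// subr_gt0.
- by rewrite bE (_ : a = s ^+ 2 - 1); [field; rewrite sN0 s1N0|rewrite sE; ring].
- by rewrite addrCA subrr addr0 divr_ge0// ltW.
Qed.

(** The same argument at the larger critical point [a + 1 + s = s (s + 1)], with [d = - s]: the
    affine factor is then positive exactly where [u > a + 1]. *)
Lemma second_order_peak_lb a u : 0 < a -> 0 <= u ->
  - (Num.sqrt (a + 1) * gamma_peak a (a + 1 + Num.sqrt (a + 1))) <=
  gamma_peak a u * (a + 1 - u).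
Proof.
move=> a0 u0; set s := Num.sqrt (a + 1).
have sE : s ^+ 2 = a + 1 by rewrite sqr_sqrtr// addr_ge0// ltW.
have s1 : 1 < s by rewrite -sqrtr1 ltr_sqrt ?ltrDr// addr_gt0.
have s0 : 0 < s by rewrite (lt_trans _ s1).
have bE : a + 1 + s = s * (s + 1) by rewrite -sE; ring.
have [h|h] := leP 0 (a + 1 - u).
  apply: (@le_trans _ _ 0); last by rewrite mulr_ge0// gamma_peak_ge0.
  by rewrite oppr_le0 mulr_ge0 ?gamma_peak_ge0// ltW.
have sN0 : s != 0 by rewrite gt_eqF.
have s1N0 : s + 1 != 0 by rewrite gt_eqF// addr_gt0.
have -> : gamma_peak a u * (a + 1 - u) =
    - (s * (gamma_peak a u * ((- s + (a + 1 + s) - u) / - s))) by field.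
rewrite lerN2 ler_wpM2l ?(ltW s0)//; apply: gamma_peak_affine_le => //.
- by rewrite bE mulr_gt0// addr_gt0.
- by rewrite oppr_eq0.
- by rewrite bE (_ : a = s ^+ 2 - 1); [field; rewrite sN0 s1N0|rewrite sE; ring].
- rewrite (_ : - s + _ = a + 1); last by ring.
  by rewrite invrN mulrN -mulNr divr_ge0 ?oppr_ge0 ?(ltW h) ?(ltW s0).
Qed.

End second_order_peak.

Section weighted_integral.
Local Open Scope ring_scope.
Context {R : realType} {d} {T : measurableType d} (mu : {measure set T -> \bar R}).
Variable w : T -> R.
Hypothesis w0 : forall y, 0 <= w y.
Hypothesis intw : mu.-integrable setT (EFin \o w).

Lemma integrable_weighted (h : T -> R) (C : R) :
  measurable_fun setT h -> (forall y, `|h y| <= C) ->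
  mu.-integrable setT (EFin \o (fun y => w y * h y)).
Proof.
move=> mh hC.
have mw : measurable_fun setT w by exact/measurable_EFinP/(measurable_int mu).
apply: (@le_integrable _ _ _ mu setT _ _ (fun y => C%:E * (EFin \o w) y)%E) => //.
- exact/measurable_EFinP/measurable_funM.
- move=> y _; rewrite lee_fin normrM mulrC normrM.
  by rewrite ler_wpM2r//; apply: le_trans (hC y) (ler_norm _).
- exact: integrableZl.
Qed.

(** Differentiation under the integral sign with dominating function [C' * w]. The bounds are asked
    only for [Q > e] because those available later blow up as the noise power tends to 0. *)
Lemma is_derive_weighted_integral (h h' : R -> T -> R) (e C C' P : R) :
  (forall Q, e < Q -> measurable_fun setT (h Q)) ->
  (forall Q y, e < Q -> `|h Q y| <= C) ->
  (forall Q y, e < Q -> is_derive Q 1 (h ^~ y) (h' Q y)) ->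
  (forall Q y, e < Q -> `|h' Q y| <= C') ->
  e < P ->
  is_derive P 1 (fun Q => \int[mu]_y (w y * h Q y)) (\int[mu]_y (w y * h' P y)).
Proof.
move=> mh hC dh h'C eP.
pose f Q y := w y * h Q y.
(* Any right end beyond [P] would do; only the left end [e] matters for the bounds. *)
have eI Q : `]e, P + 1[%classic Q -> e < Q by rewrite /= in_itv/= => /andP[].
have df Q y : e < Q -> is_derive Q 1 (f ^~ y) (w y * h' Q y).
  by move=> /(dh _ y) dhQ; exact: (is_deriveZ (w y) dhQ).
have dfE Q y : e < Q -> partial1of2 f Q y = w y * h' Q y.
  by move=> /(df _ y) [_ <-]; rewrite partial1of2E.
have IP : `]e, P + 1[%classic P by rewrite /= in_itv/= eP ltrDl ltr01.
have intf Q : `]e, P + 1[%classic Q -> mu.-integrable setT (EFin \o f Q).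
  by move=> /eI eQ; apply: integrable_weighted (mh _ eQ) _ => y; exact: hC eQ.
have derf Q y : `]e, P + 1[%classic Q -> setT y -> derivable (f ^~ y) Q 1.
  by move=> /eI/(df _ y)[].
have C'0 (y : T) : 0 <= C' by exact: (le_trans (normr_ge0 _) (h'C P y eP)).
have G0 y : 0 <= C' * w y by rewrite mulr_ge0 ?(C'0 y).
have intG : mu.-integrable setT (EFin \o (fun y => C' * w y)).
  exact: (integrableZl measurableT C' intw).
have ubG Q y : `]e, P + 1[%classic Q -> setT y -> `|partial1of2 f Q y| <= C' * w y.
  move=> /eI eQ _; rewrite dfE// normrM mulrC (ger0_norm (w0 y)) ler_wpM2r//.
  exact: h'C.
split.
  exact: (derivable_under_integral measurableT IP intf derf G0 intG ubG).
rewrite -derive1E (differentiation_under_integral measurableT IP intf derf G0 intG ubG).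
by apply: eq_Rintegral => y _; rewrite dfE.
Qed.

Variable z : T -> R.
Hypothesis z0 : forall y, 0 <= z y.
Hypothesis mz : measurable_fun setT z.
Variable a : R.
Hypothesis a0 : 0 < a.

(** In the application [w] is a Gaussian weight on R^n and [z y] depends only on the direction of
    [y]. The next two definitions are the first and second derivatives in [P]. *)
Definition gamma_mixture P := \int[mu]_y (w y * truncated_gamma a (z y * P)).

Definition gamma_mixture1 P :=
  \int[mu]_y (w y * - (gamma_peak a (z y * P)^-1 / P)).

Definition gamma_mixture2 P := \int[mu]_y
  (w y * (gamma_peak a (z y * P)^-1 * (a + 1 - (z y * P)^-1) / P ^+ 2)).

Lemma measurable_gamma_peak : measurable_fun setT (@gamma_peak R a).
Proof.
apply: measurable_funM; first exact: measurable_powR.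
by apply: measurableT_comp => //; exact: measurable_funN.
Qed.

Lemma measurable_inv_zM (P : R) : 0 < P -> measurable_fun setT (fun y => (z y * P)^-1).
Proof.
move=> P0.
rewrite (_ : (fun _ => _) = fun y => (z y * P) `^ (-1)); last first.
  by apply/funext => y; rewrite powR_inv1// mulr_ge0// ltW.
have mzP : measurable_fun setT (fun y => z y * P) by exact: measurable_funM.
exact: (measurableT_comp (@measurable_powR R (-1)) mzP).
Qed.

Lemma inv_zM_ge0 (P : R) y : 0 < P -> 0 <= (z y * P)^-1.
Proof. by move=> P0; rewrite invr_ge0 mulr_ge0// ltW. Qed.

Lemma is_derive_gamma_mixture (P : R) : 0 < P ->
  is_derive P 1 gamma_mixture (gamma_mixture1 P).
Proof.
(* Restricting to [Q > P / 2] bounds the factor [1 / Q] of the derivative. *)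
move=> P0; have e0 : 0 < P / 2 by rewrite divr_gt0.
have eQ Q : P / 2 < Q -> 0 < Q by exact: lt_trans.
apply: (@is_derive_weighted_integral (fun Q y => truncated_gamma a (z y * Q))
  (fun Q y => - (gamma_peak a (z y * Q)^-1 / Q)) (P / 2) (truncated_gamma a 0)
  (gamma_peak a a / (P / 2))).
- move=> Q _.
  have mzQ : measurable_fun setT (fun y => z y * Q) by exact: measurable_funM.
  (* Monotonicity alone yields measurability, and also the uniform bound by the value at 0 below. *)
  have mtr := nonincreasing_measurable measurableT (truncated_gamma_le a a0).
  exact: (measurableT_comp mtr mzQ).
- move=> Q y /eQ Q0; rewrite ger0_norm ?truncated_gamma_ge0//.
  by apply: truncated_gamma_le => //; rewrite mulr_ge0// ltW.
- by move=> Q y /eQ Q0; exact: is_derive_truncated_gammaM.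
- move=> Q y PQ; have Q0 := eQ _ PQ.
  rewrite normrN ger0_norm ?divr_ge0 ?gamma_peak_ge0 ?(ltW Q0)//.
  rewrite ler_pM ?gamma_peak_ge0 ?invr_ge0 ?(ltW Q0)//.
    by rewrite gamma_peak_le ?inv_zM_ge0.
  by rewrite lef_pV2 ?posrE// ltW.
- by rewrite ltr_pdivrMr// ltr_pMr// ltr1n.
Qed.

Lemma is_derive_gamma_mixture1 (P : R) : 0 < P ->
  is_derive P 1 gamma_mixture1 (gamma_mixture2 P).
Proof.
move=> P0; have e0 : 0 < P / 2 by rewrite divr_gt0.
have eQ Q : P / 2 < Q -> 0 < Q by exact: lt_trans.
pose s := Num.sqrt (a + 1).
(* The larger modulus of the two extreme values bounds the second-order integrand from both
   sides. *)
pose B := Num.max (s * gamma_peak a (a + 1 - s)) (s * gamma_peak a (a + 1 + s)).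
apply: (@is_derive_weighted_integral (fun Q y => - (gamma_peak a (z y * Q)^-1 / Q))
  (fun Q y => gamma_peak a (z y * Q)^-1 * (a + 1 - (z y * Q)^-1) / Q ^+ 2)
  (P / 2) (gamma_peak a a / (P / 2)) (B / (P / 2) ^+ 2)).
- move=> Q /eQ Q0; apply/measurable_funN/measurable_funM => //.
  exact: (measurableT_comp measurable_gamma_peak (measurable_inv_zM _ Q0)).
- move=> Q y PQ; have Q0 := eQ _ PQ.
  rewrite normrN ger0_norm ?divr_ge0 ?gamma_peak_ge0 ?(ltW Q0)//.
  rewrite ler_pM ?gamma_peak_ge0 ?invr_ge0 ?(ltW Q0)//.
    by rewrite gamma_peak_le ?inv_zM_ge0.
  by rewrite lef_pV2 ?posrE// ltW.
- by move=> Q y /eQ Q0; exact: is_derive_gamma_peakM.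
- move=> Q y PQ; have Q0 := eQ _ PQ.
  rewrite normrM [`|_ ^-1|]ger0_norm ?invr_ge0 ?exprn_ge0 ?(ltW Q0)//.
  rewrite ler_pM ?invr_ge0 ?exprn_ge0 ?(ltW Q0)//.
    have u0 := inv_zM_ge0 Q y Q0.
    rewrite ler_norml lerNl; apply/andP; split; rewrite /B le_max.
      by apply/orP; right; rewrite lerNl second_order_peak_lb.
    by rewrite second_order_peak_ub.
  by rewrite lef_pV2 ?posrE ?exprn_gt0// ler_pXn2r ?nnegrE ?(ltW PQ) ?(ltW Q0) ?(ltW e0).
- by rewrite ltr_pdivrMr// ltr_pMr// ltr1n.
Qed.

Lemma gamma_mixture2_bounds (P : R) : 0 < P -> \int[mu]_y w y = 1 ->
  - (Num.sqrt (a + 1) * gamma_peak a (a + 1 + Num.sqrt (a + 1))) / P ^+ 2 <=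
  gamma_mixture2 P <=
  Num.sqrt (a + 1) * gamma_peak a (a + 1 - Num.sqrt (a + 1)) / P ^+ 2.
Proof.
move=> P0 w1.
set lo := - _ / _; set up := _ * _ / _.
pose k y := gamma_peak a (z y * P)^-1 * (a + 1 - (z y * P)^-1) / P ^+ 2.
have klo y : lo <= k y.
  by rewrite ler_wpM2r ?invr_ge0 ?exprn_ge0 ?(ltW P0)// second_order_peak_lb ?inv_zM_ge0.
have kup y : k y <= up.
  by rewrite ler_wpM2r ?invr_ge0 ?exprn_ge0 ?(ltW P0)// second_order_peak_ub ?inv_zM_ge0.
have intk : mu.-integrable setT (EFin \o (fun y => w y * k y)).
  apply: (@integrable_weighted k (Num.max `|lo| `|up|)).
    apply: measurable_funM => //; apply: measurable_funM.
      exact: (measurableT_comp measurable_gamma_peak (measurable_inv_zM P P0)).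
    by apply: measurable_funB => //; exact: measurable_inv_zM.
  move=> y; rewrite ler_norml lerNl; apply/andP; split; rewrite le_max.
    by rewrite -normrN (le_trans _ (ler_norm _))// lerN2.
  by rewrite (le_trans (kup y) (ler_norm _)) orbT.
have intc c : mu.-integrable setT (EFin \o (fun y => c * w y)).
  exact: (integrableZl measurableT c intw).
(* As [w] has total mass 1, each constant bound is itself a weighted integral, and the pointwise
   bounds can be integrated. *)
have cE c : \int[mu]_y (c * w y) = c by rewrite RintegralZl// w1 mulr1.
rewrite (_ : gamma_mixture2 P = \int[mu]_y (w y * k y))//; apply/andP; split.
  rewrite -[leLHS]cE; apply: le_Rintegral => // y _.
  by rewrite mulrC ler_wpM2l.
rewrite -[leRHS]cE; apply: le_Rintegral => // y _.
by rewrite [leRHS]mulrC ler_wpM2l.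
Qed.

End weighted_integral.

(** * Lebesgue measure on R^n under dilations *)

Section lebesgue_Rn_integral.
Local Open Scope ring_scope.
Context {R : realType}.
Local Notation mR := (measurableTypeR R).
Local Notation leb := (@lebesgue_measure R).

(** By uniqueness of Lebesgue measure: [c] times its pushforward under [x |-> c x] gives each
    half-open interval its length. *)
Lemma ge0_integral_dilation (c : R) (h : mR -> \bar R) : 0 < c ->
  measurable_fun setT h -> (forall x, 0 <= h x)%E ->
  (\int[leb]_x h x = c%:E * \int[leb]_x h (c * x)%R)%E.
Proof.
move=> c0 mh h0.
have mc : measurable_fun setT (fun x : mR => (c * x : mR)).
  exact: (@measurable_funM _ _ R setT (cst c) id).
have c0' : 0 <= c by exact: ltW.
pose pf := measure_function_pushforward__canonical__measure_function_Measure leb mc.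
pose nu := mscale (NngNum c0') pf.
have nuE A : measurable A -> leb A = nu A.
  apply: lebesgue_measure_unique => //= _ [[a b]] _ <-.
  rewrite /nu /mscale/= /pushforward.
  rewrite [X in (_ * leb X)%E](_ : _ = `](c^-1 * a), (c^-1 * b)]%classic); last first.
    apply/seteqP; split => x; rewrite /= !in_itv/= ![(c^-1 * _)%R]mulrC.
      by rewrite ltr_pdivrMr// ler_pdivlMr// ![(x * c)%R]mulrC.
    by rewrite ltr_pdivrMr// ler_pdivlMr// ![(x * c)%R]mulrC.
  rewrite !lebesgue_measure_itv/= !lte_fin ltr_pM2l ?invr_gt0//.
  case: ifPn => ab; last by rewrite mule0.
  by rewrite -!EFinB -EFinM -mulrBr mulVKf ?gt_eqF.
rewrite (eq_measure_integral nu); last by move=> A mA _; exact: nuE.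
rewrite ge0_integral_mscale//= ge0_integral_pushforward//=.
Qed.

Lemma integral_lebesgue_RnS n (f : n.+1.-tuple mR -> \bar R) :
  measurable_fun setT f -> (forall t, 0 <= f t)%E ->
  (\int[lebesgue_Rn n.+1]_t f t =
   \int[leb]_x \int[lebesgue_Rn n]_t f (tuple_pair (x, t)))%E.
Proof.
move=> mf f0.
transitivity (\int[pushforward (leb \x lebesgue_Rn n)%E (@tuple_pair R n)]_t f t)%E => //.
rewrite ge0_integral_pushforward//=; last exact: measurable_tuple_pair.
rewrite preimage_setT fubini_tonelli1//.
exact: (measurableT_comp mf (@measurable_tuple_pair R n)).
Qed.

Definition dilation_tuple {n} (c : R) (t : n.-tuple mR) : n.-tuple mR :=
  map_tuple (fun x : mR => (c * x : mR)) t.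

Definition sqnorm_tuple {n} (t : n.-tuple mR) : R := \sum_i (tnth t i : R) ^+ 2.

Lemma measurable_dilation_tuple n :
  measurable_fun setT (fun ct : mR * n.-tuple mR => dilation_tuple ct.1 ct.2).
Proof.
apply/measurable_fun_tnthP => i.
rewrite (_ : _ \o _ = fun ct : mR * n.-tuple mR => (ct.1 * tnth ct.2 i : mR)); last first.
  by apply/funext => ct /=; rewrite tnth_map.
apply: (@measurable_funM _ _ R) => //.
exact: (measurableT_comp (measurable_tnth i)).
Qed.

Lemma measurable_sqnorm_tuple n : measurable_fun setT (@sqnorm_tuple n).
Proof.
apply: measurable_sum => i.
exact: (@measurable_funX _ _ R _ _ 2 (measurable_tnth i)).
Qed.

(** Induction on the dimension: Tonelli splits off one coordinate, and the one-dimensional dilation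
    contributes one more factor [c]. *)
Lemma ge0_integral_dilation_tuple n (c : R) (h : n.-tuple mR -> \bar R) : 0 < c ->
  measurable_fun setT h -> (forall t, 0 <= h t)%E ->
  (\int[lebesgue_Rn n]_t h t =
   (c ^+ n)%:E * \int[lebesgue_Rn n]_t h (dilation_tuple c t))%E.
Proof.
move=> c0; elim: n h => [|n IH] h mh h0.
  have mh' : measurable_fun setT (fun t => h (dilation_tuple c t)).
    exact: (measurableT_comp mh
      (measurableT_comp (measurable_dilation_tuple 0) (pair1_measurable c))).
  rewrite expr0 mul1e /= integral_dirac// integral_dirac//.
  by congr (_ * h _)%E; exact/val_inj.
have mD k : measurable_fun setT (@dilation_tuple k c).
  exact: (measurableT_comp (measurable_dilation_tuple k) (pair1_measurable c)).
have mhp : measurable_fun setT (h \o @tuple_pair R n).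
  exact: (measurableT_comp mh (@measurable_tuple_pair R n)).
have mhx x : measurable_fun setT (fun t => h (tuple_pair (x, t))).
  exact: (measurableT_comp mhp (pair1_measurable x)).
have mhd : measurable_fun setT
    (fun xt : mR * n.-tuple mR => h (tuple_pair (xt.1, dilation_tuple c xt.2))).
  apply: (measurableT_comp mhp).
  apply/measurable_fun_pair => //=; exact: (measurableT_comp (mD n)).
rewrite !integral_lebesgue_RnS//; last exact: (measurableT_comp mh (mD _)).
under eq_integral => x _ do rewrite (IH (fun t => h (tuple_pair (x, t)))) //.
rewrite ge0_integralZl//; first last.
- by rewrite lee_fin exprn_ge0// ltW.
- by move=> x _; exact: integral_ge0.
- exact: (@measurable_fun_fubini_tonelli_F _ _ _ _ R (lebesgue_Rn n) _ mhd (fun=> h0 _)).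
pose A x := (\int[lebesgue_Rn n]_t h (tuple_pair (x, dilation_tuple c t)))%E.
rewrite [X in (_ * X)%E](ge0_integral_dilation c A)//; last 2 first.
- exact: (@measurable_fun_fubini_tonelli_F _ _ _ _ R (lebesgue_Rn n) _ mhd (fun=> h0 _)).
- by move=> x; exact: integral_ge0.
rewrite muleA -EFinM -exprSr; congr (_ * _)%E.
apply: eq_integral => x _; apply: eq_integral => t _; congr h.
exact/val_inj.
Qed.

Lemma measurable_gauss_tuple n :
  measurable_fun setT (fun t : n.-tuple mR => (expR (- sqnorm_tuple t))%:E).
Proof.
apply/measurable_EFinP; apply: (@measurableT_comp _ _ _ _ _ _ (@expR R)) => //.
by apply/measurable_funN; exact: measurable_sqnorm_tuple.
Qed.

Lemma sqnorm_tuple_pair n (x : R) (t : n.-tuple mR) :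
  sqnorm_tuple (tuple_pair (x : mR, t)) = x ^+ 2 + sqnorm_tuple t.
Proof.
rewrite /sqnorm_tuple big_ord_recl; congr (_ + _).
by apply: eq_bigr => i _; rewrite tnthS.
Qed.

Lemma integral_gauss_tuple n :
  (\int[lebesgue_Rn n]_t (expR (- sqnorm_tuple t))%:E = (Num.sqrt pi ^+ n)%:E)%E.
Proof.
elim: n => [|n IH].
  rewrite /= integral_dirac//; last exact: measurable_gauss_tuple.
  rewrite [X in (X * _)%E]diracT mul1e.
  by rewrite /sqnorm_tuple big_ord0 oppr0 expR0.
have g0 (t : n.+1.-tuple mR) : (0 <= (expR (- sqnorm_tuple t))%:E)%E.
  by rewrite lee_fin expR_ge0.
rewrite (integral_lebesgue_RnS _ _ (measurable_gauss_tuple n.+1) g0).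
under eq_integral => x _.
  under eq_integral => t _ do rewrite sqnorm_tuple_pair opprD expRD EFinM.
  rewrite ge0_integralZl//; last exact: (@measurable_gauss_tuple n).
  rewrite [X in (_ * X)%E]IH.
  over.
have mg : measurable_fun setT (fun x : mR => (expR (- (x : R) ^+ 2))%:E).
  apply/measurable_EFinP; apply: (@measurableT_comp _ _ _ _ _ _ (@expR R)) => //.
  by apply/measurable_funN; exact: (@measurable_funX _ _ R setT id 2).
rewrite (ge0_integralZr _ measurableT mg); last 2 first.
- by move=> x _; rewrite lee_fin expR_ge0.
- by rewrite lee_fin exprn_ge0// sqrtr_ge0.
by rewrite exprS EFinM -integralT_gauss.
Qed.

(** The origin is a box with sides of length 0. In dimension 0 this fails, the measure being a point
    mass. Rescaling by the squared norm breaks down only on this null set. *)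
Lemma lebesgue_Rn_set0 n : (0 < n)%N ->
  lebesgue_Rn n [set t : n.-tuple mR | sqnorm_tuple t = 0] = 0%E.
Proof.
move=> n0.
rewrite (_ : [set _ | _] = [set t | forall i : 'I_n, [set (0 : R)] (tnth t i)]).
  rewrite (@lebesgue_Rn_box R n (fun=> [set (0 : R)] : set mR))//.
  case: n n0 => // n _.
  by rewrite big_ord_recl/= lebesgue_measure_set1 mul0e.
apply/seteqP; split => t /=.
  move=> /eqP; rewrite psumr_eq0 => [/allP h i|i _]; last exact: sqr_ge0.
  by apply/eqP; have := h i (mem_index_enum _); rewrite sqrf_eq0.
by move=> h; rewrite /sqnorm_tuple big1// => i _; rewrite h expr0n.
Qed.

End lebesgue_Rn_integral.

(** * Radial averaging *)

Section radial_average.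
Local Open Scope ring_scope.
Context {R : realType}.
Local Notation mR := (measurableTypeR R).
Local Notation leb := (@lebesgue_measure R).

Lemma sqnorm_tuple_ge0 n (y : n.-tuple mR) : 0 <= sqnorm_tuple y.
Proof. by apply: sumr_ge0 => i _; exact: sqr_ge0. Qed.

Lemma sqnorm_dilation_tuple n (c : R) (y : n.-tuple mR) :
  sqnorm_tuple (dilation_tuple c y) = c ^+ 2 * sqnorm_tuple y.
Proof.
rewrite /sqnorm_tuple mulr_sumr; apply: eq_bigr => i _.
by rewrite tnth_map exprMn.
Qed.

Lemma powR_half_sqr (t : R) : 0 <= t -> (t `^ 2^-1) ^+ 2 = t.
Proof. by move=> t0; rewrite powR12_sqrt// sqr_sqrtr. Qed.

Lemma powR_half_exp (t : R) n : (t `^ 2^-1) ^+ n = t `^ (n%:R / 2).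
Proof. by rewrite -powR_mulrn ?powR_ge0// -powRrM mulrC. Qed.

(* Radial integrals are taken over the whole line, with this indicator as a
   factor, so that Tonelli's theorem applies directly. *)
Definition posind (t : R) : R := \1_(`]0, +oo[%classic : set R) t.

Lemma posind_ge0 t : 0 <= posind t. Proof. by rewrite /posind indicE. Qed.

Lemma posindT t : 0 < t -> posind t = 1.
Proof. by move=> t0; rewrite /posind indicE mem_set//= in_itv/= t0. Qed.

Lemma posindF t : t <= 0 -> posind t = 0.
Proof.
move=> t0; rewrite /posind indicE memNset//= in_itv/= andbT.
by apply/negP; rewrite -leNgt.
Qed.

Lemma posindM c t : 0 < c -> posind (c * t) = posind t.
Proof.
move=> c0; have [t0|t0] := leP t 0; last by rewrite !posindT// mulr_gt0.
by rewrite !posindF// mulr_ge0_le0// ltW.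
Qed.

Lemma measurable_posind : measurable_fun setT posind.
Proof. exact: measurable_indic. Qed.

Lemma integral_posind (f : R -> \bar R) :
  (\int[leb]_(t in `]0%R, +oo[) f t = \int[leb]_t ((posind t)%:E * f t))%E.
Proof.
rewrite integral_mkcond; apply: eq_integral => t _.
rewrite patchE /posind indicE; case: ifPn => _; by rewrite ?mul1e ?mul0e.
Qed.

(* [t `^ (-1)] and [t `^ 2^-1] are used for the inverse and the square root of
   [t > 0] because [measurable_powR] applies to them. *)
Definition radial_const (a : R) : \bar R :=
  (\int[leb]_t (posind t * t `^ (-1) * gamma_peak a (t `^ (-1)))%:E)%E.

Lemma measurable_radial_density (a s : R) :
  measurable_fun setT (fun t => posind t * t `^ (-1) * gamma_peak a (s * t `^ (-1))).
Proof.
apply: measurable_funM.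
  by apply: measurable_funM; [exact: measurable_posind|exact: measurable_powR].
have h : measurable_fun setT (fun t : R => s * t `^ (-1)).
  by apply: measurable_funM => //; exact: measurable_powR.
exact: (measurableT_comp (measurable_gamma_peak a) h).
Qed.

(** The measure [dt / t] on the positive half-line is invariant under dilations, so [s] drops
    out. *)
Lemma integral_radial_density (a s : R) : 0 < s ->
  (\int[leb]_t (posind t * t `^ (-1) * gamma_peak a (s * t `^ (-1)))%:E =
   radial_const a)%E.
Proof.
move=> s0; rewrite (ge0_integral_dilation s)//; first last.
- by move=> t; rewrite lee_fin !mulr_ge0 ?posind_ge0 ?powR_ge0 ?gamma_peak_ge0.
- by apply/measurable_EFinP; apply: measurable_radial_density.
rewrite -ge0_integralZl//; last 3 first.
- apply/measurable_EFinP.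
  have ms : measurable_fun setT (fun t : R => s * t) by exact: measurable_funM.
  exact: (measurableT_comp (measurable_radial_density a s) ms).
- by move=> t; rewrite lee_fin !mulr_ge0 ?posind_ge0 ?powR_ge0 ?gamma_peak_ge0.
- by rewrite lee_fin ltW.
apply: eq_integral => t _; rewrite -EFinM posindM//; congr EFin.
have [t0|t0] := leP t 0; first by rewrite posindF// !mul0r mulr0.
have stV : s * (s * t) `^ (-1) = t `^ (-1).
  by rewrite !powR_inv1 ?mulr_ge0 ?(ltW s0) ?(ltW t0)// invfM mulVKf ?gt_eqF.
by rewrite stV -!mulrA (mulrCA s) (mulrA s) stV.
Qed.


Section average.
Variable n : nat.
Hypothesis n0 : (0 < n)%N.
Let a : R := n%:R / 2.
Local Notation mu := (lebesgue_Rn n).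

Lemma measurable_dilation_half : measurable_fun setT
  (fun ty : mR * n.-tuple mR => dilation_tuple ((ty.1 : R) `^ 2^-1) ty.2).
Proof.
have h : measurable_fun setT
    (fun ty : mR * n.-tuple mR => ((ty.1 : R) `^ 2^-1 : mR, ty.2)).
  apply/measurable_fun_pair => //=.
  exact: (measurableT_comp (@measurable_powR R 2^-1)).
exact: (measurableT_comp (measurable_dilation_tuple n) h).
Qed.

Variable h : n.-tuple mR -> \bar R.
Hypothesis mh : measurable_fun setT h.
Hypothesis h0 : forall y, (0 <= h y)%E.

(** As [a = n / 2], the peak function of the squared norm is [|y|^n e^(-|y|^2)]. *)
Let Fty (ty : mR * n.-tuple mR) : \bar R :=
  ((posind ty.1 * (ty.1 : R) `^ (a - 1) * gamma_peak a (sqnorm_tuple ty.2))%:E *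
    h (dilation_tuple ((ty.1 : R) `^ 2^-1) ty.2))%E.

Lemma measurable_average_integrand : measurable_fun setT Fty.
Proof.
apply: emeasurable_funM; last exact: (measurableT_comp mh measurable_dilation_half).
apply/measurable_EFinP; apply: measurable_funM; first apply: measurable_funM.
- exact: (measurableT_comp measurable_posind).
- exact: (measurableT_comp (@measurable_powR R (a - 1))).
- apply: (measurableT_comp (measurable_gamma_peak a)).
  exact: (measurableT_comp (measurable_sqnorm_tuple n)).
Qed.

(** [Fty] in the variable [x = sqrt t y]: the Jacobian [t^(-n/2)] leaves only [t^-1] of the power
    [t^(a-1)]. *)
Let Gtx (tx : mR * n.-tuple mR) : \bar R :=
  ((posind tx.1 * (tx.1 : R) `^ (-1) *
    gamma_peak a (sqnorm_tuple tx.2 * (tx.1 : R) `^ (-1)))%:E *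
    h tx.2)%E.

Let Gtx_ge0 tx : (0 <= Gtx tx)%E.
Proof. by rewrite mule_ge0// lee_fin !mulr_ge0 ?posind_ge0 ?powR_ge0 ?gamma_peak_ge0. Qed.

Let measurable_Gtx : measurable_fun setT Gtx.
Proof.
apply: emeasurable_funM; last exact: (measurableT_comp mh).
have mV : measurable_fun setT (fun tx : mR * n.-tuple mR => (tx.1 : R) `^ (-1)).
  exact: (measurableT_comp (@measurable_powR R (-1))).
apply/measurable_EFinP; apply: measurable_funM; first apply: measurable_funM => //.
- exact: (measurableT_comp measurable_posind).
- apply: (measurableT_comp (measurable_gamma_peak a)); apply: measurable_funM => //.
  exact: (measurableT_comp (measurable_sqnorm_tuple n)).
Qed.

(* Substitute [x = sqrt t y] in the inner integral, exchange the integrals, and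
   rescale [t] by [|x|^2], which is possible outside the null set [x = 0]. *)
Lemma integral_average :
  (\int[leb]_t \int[mu]_y Fty (t, y) = radial_const a * \int[mu]_y h y)%E.
Proof.
transitivity (\int[leb]_t \int[mu]_x Gtx (t, x))%E.
  apply: eq_integral => t _.
  have [t0|t0] := leP (t : R) 0.
    by rewrite !integral0_eq// => x _; rewrite /Fty /Gtx /= posindF// !mul0r mul0e.
  have r0 : 0 < t `^ 2^-1 by rewrite powR_gt0.
  have rn0 : (0 <= ((t `^ 2^-1) ^+ n)%:E)%E by rewrite lee_fin exprn_ge0// ltW.
  have mGt := measurableT_comp measurable_Gtx (pair1_measurable t).
  have mdil := measurableT_comp (measurable_dilation_tuple n)
    (pair1_measurable (t `^ 2^-1 : mR)).
  rewrite (ge0_integral_dilation_tuple n (t `^ 2^-1) (fun x => Gtx (t, x))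
    r0 mGt (fun x => Gtx_ge0 (t, x))).
  rewrite -(ge0_integralZl mu measurableT (measurableT_comp mGt mdil)
    (fun y _ => Gtx_ge0 (t, dilation_tuple (t `^ 2^-1) y)) rn0).
  apply: eq_integral => y _; rewrite /Fty /Gtx /= muleA -EFinM; congr (_%:E * _)%E.
  rewrite sqnorm_dilation_tuple powR_half_sqr ?(ltW t0)// powR_half_exp -/a.
  rewrite powR_inv1 ?(ltW t0)// powRB ?(gt_eqF t0) ?implybT// powRr1 ?(ltW t0)//.
  rewrite (_ : t * sqnorm_tuple y / t = sqnorm_tuple y); last by field; rewrite gt_eqF.
  by ring.
rewrite (fubini_tonelli _ measurable_Gtx Gtx_ge0).
rewrite -ge0_integralZl//; last first.
  apply: integral_ge0 => t _.
  by rewrite lee_fin !mulr_ge0 ?posind_ge0 ?powR_ge0 ?gamma_peak_ge0.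
apply: ge0_ae_eq_integral => //.
- exact: (measurable_fun_fubini_tonelli_G _ measurable_Gtx Gtx_ge0).
- exact: measurable_funeM.
- by move=> x _; exact: integral_ge0.
- move=> x _; rewrite mule_ge0//.
  apply: integral_ge0 => t _.
  by rewrite lee_fin !mulr_ge0 ?posind_ge0 ?powR_ge0 ?gamma_peak_ge0.
exists [set x | sqnorm_tuple x = 0]; split.
- rewrite -[X in measurable X]setTI.
  exact: (measurable_sqnorm_tuple n measurableT _ (measurable_set1 (0 : R))).
- exact: lebesgue_Rn_set0.
move=> x /=; apply: contra_notP => x0 _.
have sx0 : 0 < sqnorm_tuple x by rewrite lt0r sqnorm_tuple_ge0 andbT; apply/eqP.
have mrad : measurable_fun setT (fun t : mR => (posind t * (t : R) `^ (-1) *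
    gamma_peak a (sqnorm_tuple x * (t : R) `^ (-1)))%:E).
  by apply/measurable_EFinP; exact: measurable_radial_density.
have rad0 (t : mR) : setT t -> (0 <= (posind t * (t : R) `^ (-1) *
    gamma_peak a (sqnorm_tuple x * (t : R) `^ (-1)))%:E)%E.
  by move=> _; rewrite lee_fin !mulr_ge0 ?posind_ge0 ?powR_ge0 ?gamma_peak_ge0.
rewrite /Gtx/= (ge0_integralZr _ measurableT mrad rad0 (h0 x)).
by rewrite integral_radial_density.
Qed.

End average.

End radial_average.

(** * Gaussian probability of a set as an average over rays *)

Section radial_formula.
Local Open Scope ring_scope.
Context {R : realType}.
Local Notation mR := (measurableTypeR R).
Local Notation leb := (@lebesgue_measure R).
Variable n : nat.
Hypothesis n0 : (0 < n)%N.
Let a : R := n%:R / 2.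
Local Notation mu := (lebesgue_Rn n).

Let a0 : 0 < a. Proof. by rewrite divr_gt0// ltr0n. Qed.

Definition gauss_density (P : R) (y : n.-tuple mR) : R :=
  (2 * pi * P) `^ (- (n%:R / 2)) * expR (- (sqnorm_tuple y / (2 * P))).

(** The Gaussian density of noise power 1/2. It does not involve [P] and serves as the weight over
    directions. *)
Definition gauss_weight (y : n.-tuple mR) : R :=
  pi `^ (- (n%:R / 2)) * expR (- sqnorm_tuple y).

Lemma gauss_density_ge0 P y : 0 <= gauss_density P y.
Proof. by rewrite mulr_ge0 ?powR_ge0 ?expR_ge0. Qed.

Lemma gauss_weight_ge0 y : 0 <= gauss_weight y.
Proof. by rewrite mulr_ge0 ?powR_ge0 ?expR_ge0. Qed.

Lemma measurable_gauss_density P : measurable_fun setT (gauss_density P).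
Proof.
apply: measurable_funM => //.
apply: (@measurableT_comp _ _ _ _ _ _ (@expR R)) => //; apply/measurable_funN.
by apply: measurable_funM => //; exact: measurable_sqnorm_tuple.
Qed.

Lemma measurable_gauss_weight : measurable_fun setT gauss_weight.
Proof.
apply: measurable_funM => //.
by apply/measurable_EFinP; exact: measurable_gauss_tuple.
Qed.

Lemma integral_gauss_weight : (\int[mu]_y (gauss_weight y)%:E = 1)%E.
Proof.
rewrite (eq_integral (fun y =>
  (pi `^ (- (n%:R / 2)))%:E * (expR (- sqnorm_tuple y))%:E)%E)//.
rewrite ge0_integralZl//; last 2 first.
- exact: measurable_gauss_tuple.
- by rewrite lee_fin powR_ge0.
rewrite integral_gauss_tuple -EFinM; congr EFin.
by rewrite -powR12_sqrt ?pi_ge0// powR_half_exp powRN mulVf// gt_eqF// powR_gt0// pi_gt0.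
Qed.

Lemma integral_gauss_density P : 0 < P -> (\int[mu]_y (gauss_density P y)%:E = 1)%E.
Proof.
move=> P0; have P2 : 0 < 2 * P by rewrite mulr_gt0.
rewrite (ge0_integral_dilation_tuple n ((2 * P) `^ 2^-1))//; last 3 first.
- by rewrite powR_gt0.
- by apply/measurable_EFinP; exact: measurable_gauss_density.
- by move=> y; rewrite lee_fin gauss_density_ge0.
rewrite -integral_gauss_weight -ge0_integralZl//; last 3 first.
- have mdil := measurableT_comp (measurable_dilation_tuple n)
    (pair1_measurable ((2 * P) `^ 2^-1 : mR)).
  apply/measurable_EFinP; exact: (measurableT_comp (measurable_gauss_density P) mdil).
- by move=> y _; rewrite lee_fin gauss_density_ge0.
- by rewrite lee_fin exprn_ge0// powR_ge0.
apply: eq_integral => y _; rewrite -EFinM; congr EFin.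
rewrite /gauss_density /gauss_weight sqnorm_dilation_tuple powR_half_sqr ?(ltW P2)//.
rewrite powR_half_exp (mulrAC 2) [(2 * P * pi) `^ _]powRM ?pi_ge0 ?(ltW P2)//.
rewrite [(2 * P) `^ (- _)]powRN mulrA mulrA divff ?mul1r.
  by rewrite (_ : 2 * P * _ / _ = sqnorm_tuple y)//; field; rewrite gt_eqF.
by rewrite gt_eqF// powR_gt0.
Qed.

Section domain.
Variables (D : set (n.-tuple mR)) (P : R).
Hypothesis mD : measurable D.
Hypothesis P0 : 0 < P.

Let h (y : n.-tuple mR) : \bar R := (\1_D y * gauss_density P y)%:E.

Let mh : measurable_fun setT h.
Proof.
apply/measurable_EFinP; apply: measurable_funM; last exact: measurable_gauss_density.
exact: measurable_indic.
Qed.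

Let h0 y : (0 <= h y)%E.
Proof. by rewrite lee_fin mulr_ge0 ?gauss_density_ge0 ?indicE. Qed.

(** For [y] nonzero and [t >= 0], the point [x] on the ray through [y] with [|x|^2 / (2 P) = t]. *)
Let ray (t : R) (y : n.-tuple mR) : n.-tuple mR :=
  dilation_tuple ((2 * P * t * sqnorm_tuple y `^ (-1)) `^ 2^-1) y.

Let Gty (ty : mR * n.-tuple mR) : \bar R :=
  (gauss_weight ty.2 * (posind ty.1 * gamma_density a ty.1 * \1_D (ray ty.1 ty.2)))%:E.

Let Gty_ge0 ty : (0 <= Gty ty)%E.
Proof.
by rewrite lee_fin !mulr_ge0 ?gauss_weight_ge0 ?posind_ge0 ?gamma_density_ge0
  ?indicE ?powR_ge0.
Qed.

Let measurable_ray : measurable_fun setT (fun ty : mR * n.-tuple mR => ray ty.1 ty.2).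
Proof.
have h1 : measurable_fun setT (fun ty : mR * n.-tuple mR =>
    (2 * P * (ty.1 : R) * sqnorm_tuple ty.2 `^ (-1))).
  apply: measurable_funM; first exact: (@measurable_funM _ _ R _ (cst (2 * P)) fst).
  apply: (measurableT_comp (@measurable_powR R (-1))).
  exact: (measurableT_comp (measurable_sqnorm_tuple n)).
have h2 : measurable_fun setT (fun ty : mR * n.-tuple mR =>
    (((2 * P * (ty.1 : R) * sqnorm_tuple ty.2 `^ (-1)) `^ 2^-1) : mR, ty.2)).
  apply/measurable_fun_pair => //=.
  exact: (measurableT_comp (@measurable_powR R 2^-1) h1).
exact: (measurableT_comp (measurable_dilation_tuple n) h2).
Qed.

Let measurable_Gty : measurable_fun setT Gty.
Proof.
apply/measurable_EFinP; apply: measurable_funM.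
  exact: (measurableT_comp measurable_gauss_weight).
apply: measurable_funM.
  apply: measurable_funM; first exact: (measurableT_comp measurable_posind).
  exact: (measurableT_comp (measurable_gamma_density a setT)).
have m1 : measurable_fun setT (\1_D : n.-tuple mR -> R) by exact: measurable_indic.
exact: (measurableT_comp m1 measurable_ray).
Qed.

(** Apply [integral_average] to the density restricted to [D], exchange the integrals, and for fixed
    nonzero [y] rescale [t] by [2 P / |y|^2]. The new [t] is [|x|^2 / (2 P)], and all powers of [P]
    and [|y|] cancel, so that [P] survives only inside [ray]. *)
Lemma radial_formula :
  (radial_const a * \int[mu]_y (\1_D y * gauss_density P y)%:E =
   \int[mu]_y \int[leb]_t (gauss_weight y *
     (posind t * gamma_density a t * \1_D (ray t y)))%:E)%E.
Proof.
rewrite -(integral_average n n0 h mh h0).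
rewrite (fubini_tonelli _ (measurable_average_integrand n h mh)); last first.
  by move=> ty; rewrite mule_ge0// lee_fin !mulr_ge0 ?posind_ge0 ?powR_ge0 ?gamma_peak_ge0.
have mF := measurable_average_integrand n h mh.
apply: ge0_ae_eq_integral => //.
- apply: (measurable_fun_fubini_tonelli_G _ mF).
  by move=> ty; rewrite mule_ge0// lee_fin !mulr_ge0 ?posind_ge0 ?powR_ge0 ?gamma_peak_ge0.
- exact: (measurable_fun_fubini_tonelli_G _ measurable_Gty Gty_ge0).
- move=> y _; apply: integral_ge0 => t _.
  by rewrite mule_ge0// lee_fin !mulr_ge0 ?posind_ge0 ?powR_ge0 ?gamma_peak_ge0.
- by move=> y _; apply: integral_ge0 => t _; exact: (Gty_ge0 (t, y)).
exists [set y | sqnorm_tuple y = 0]; split.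
- rewrite -[X in measurable X]setTI.
  exact: (measurable_sqnorm_tuple n measurableT _ (measurable_set1 (0 : R))).
- exact: lebesgue_Rn_set0.
move=> y /=; apply: contra_notP => yN0 _.
have y0 : 0 < sqnorm_tuple y by rewrite lt0r sqnorm_tuple_ge0 andbT; apply/eqP.
have P2 : 0 < 2 * P by rewrite mulr_gt0.
have c0 : 0 < 2 * P / sqnorm_tuple y by rewrite divr_gt0.
rewrite (ge0_integral_dilation (2 * P / sqnorm_tuple y))//; last 2 first.
- exact: (measurableT_comp mF (pair2_measurable y)).
- by move=> t; rewrite mule_ge0// lee_fin !mulr_ge0 ?posind_ge0 ?powR_ge0 ?gamma_peak_ge0.
rewrite -ge0_integralZl//; last 3 first.
- have mc : measurable_fun setT (fun t : mR => (2 * P / sqnorm_tuple y * t : mR)).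
    exact: (@measurable_funM _ _ R setT (cst _) id).
  exact: (measurableT_comp (measurableT_comp mF (pair2_measurable y)) mc).
- by move=> t _; rewrite mule_ge0// lee_fin !mulr_ge0 ?posind_ge0 ?powR_ge0 ?gamma_peak_ge0.
- by rewrite lee_fin ltW.
apply: eq_integral => t _; rewrite /h/= -!EFinM posindM//; congr EFin.
have [t0|t0] := leP (t : R) 0; first by rewrite posindF// !(mul0r, mulr0).
have ct0 : 0 < 2 * P / sqnorm_tuple y * t by rewrite mulr_gt0.
rewrite /ray powR_inv1 ?(ltW y0)// (mulrAC (2 * P) t).
set c := 2 * P / _ in c0 ct0 *.
rewrite /gauss_density sqnorm_dilation_tuple powR_half_sqr ?(ltW ct0)//.
have -> : c * t * sqnorm_tuple y / (2 * P) = t.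
  by rewrite /c; field; rewrite !gt_eqF.
rewrite /gauss_weight /gamma_density /gamma_peak -/a.
have -> : (c * t) `^ (a - 1) = c `^ a / c * t `^ (a - 1).
  rewrite powRM ?(ltW c0) ?(ltW t0)//; congr (_ * _).
  by rewrite powRB ?(gt_eqF c0) ?implybT// powRr1// ltW.
have -> : c `^ a = (2 * P) `^ a / sqnorm_tuple y `^ a.
  rewrite /c powRM ?invr_ge0 ?(ltW P2) ?(ltW y0)//; congr (_ * _).
  by rewrite -powR_inv1 ?(ltW y0)// -powRrM mulN1r powRN.
rewrite (mulrAC 2) [(2 * P * pi) `^ _]powRM ?pi_ge0 ?(ltW P2)// [(2 * P) `^ (- a)]powRN.
have A1 : sqnorm_tuple y `^ a != 0 by rewrite gt_eqF// powR_gt0.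
have A2 : (2 * P) `^ a != 0 by rewrite gt_eqF// powR_gt0.
have A3 : c != 0 by rewrite gt_eqF.
by field; rewrite A1 A2 A3.
Qed.

End domain.

(** Take [D] to be the whole space and [P = 1] in [radial_formula]: both Gaussians integrate to 1,
    and only the gamma integral remains on the right. *)
Lemma radial_constE : radial_const a = (Gamma a)%:E.
Proof.
have gE : (\int[leb]_t (posind t * gamma_density a t)%:E = (Gamma a)%:E)%E.
  rewrite /Gamma /Rintegral fineK; last first.
    apply: (@integrable_fin_num _ (measurableTypeR R)) => //.
    exact: (integrable_gamma_density a a0).
  by rewrite integral_posind; apply: eq_integral => t _; rewrite -EFinM.
have := radial_formula setT 1 measurableT ltr01.
under eq_integral do rewrite indicE in_setT mul1r.
rewrite integral_gauss_density// mule1 => ->.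
rewrite -gE -[RHS]mul1e -integral_gauss_weight -ge0_integralZr//; last 3 first.
- by apply/measurable_EFinP; exact: measurable_gauss_weight.
- by move=> y _; rewrite lee_fin gauss_weight_ge0.
- by apply: integral_ge0 => t _; rewrite lee_fin mulr_ge0 ?posind_ge0 ?gamma_density_ge0.
apply: eq_integral => y _; rewrite -ge0_integralZl//; last 3 first.
- apply/measurable_EFinP; apply: measurable_funM; first exact: measurable_posind.
  exact: measurable_gamma_density.
- by move=> t _; rewrite lee_fin mulr_ge0 ?posind_ge0 ?gamma_density_ge0.
- by rewrite lee_fin gauss_weight_ge0.
by apply: eq_integral => t _; rewrite indicE in_setT mulr1 -EFinM.
Qed.

End radial_formula.

Section gamma_pos.
Local Open Scope ring_scope.
Context {R : realType}.

(** If [Gamma a] were 0, the truncated integral, caught between 0 and [Gamma a], would vanish near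
    [v = 1], against its nonzero derivative there. *)
Lemma Gamma_gt0 (a : R) : 0 < a -> 0 < Gamma a.
Proof.
move=> a0; rewrite -truncated_gamma0 lt0r truncated_gamma_ge0 andbT.
apply/eqP => G0.
have e : is_derive (1 : R) 1 (truncated_gamma a) 0.
  have c : is_derive (1 : R) 1 (cst 0 : R -> R) 0 := is_derive_cst _ _ _.
  apply: near_eq_is_derive c; near=> v; rewrite /cst/=; apply/eqP.
  rewrite eq_le truncated_gamma_ge0 -[leRHS]G0 truncated_gamma_le//.
  by apply/ltW; near: v; exact: lt_nbhsr.
have [_ e1] := is_derive_truncated_gamma a 1 a0 ltr01.
have := e1; rewrite (@derive_val _ _ _ _ _ _ _ e) => /esym/eqP.
by rewrite oppr_eq0 divr1 invr1 gt_eqF// mulr_gt0 ?powR_gt0 ?expR_gt0.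
Unshelve. all: end_near. Qed.

End gamma_pos.

(** * Decision regions *)

Section region.
Local Open Scope ring_scope.
Context {R : realType} (M n : nat) (s : 'I_M -> 'cV[R]_n).
Local Notation mR := (measurableTypeR R).
Local Notation leb := (@lebesgue_measure R).
Local Notation mu := (lebesgue_Rn n).
Variable i : 'I_M.
Hypothesis injs : injective s.
Hypothesis n0 : (0 < n)%N.
Let a : R := n%:R / 2.
Let a0 : 0 < a. Proof. by rewrite divr_gt0// ltr0n. Qed.

Let inner (j : 'I_M) (y : n.-tuple mR) : R := ((s j - s i)^T *m col_of_tuple y) 0 0.
Let bound (j : 'I_M) : R := 2^-1 * enorm (s j - s i) ^+ 2.

(* The Minkowski functional of the decision region. *)
Definition region_gauge (y : n.-tuple mR) : R :=
  \big[Num.max/0]_(j < M | j != i) (inner j y / bound j).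

Lemma enorm_sqr (x : 'cV[R]_n) : enorm x ^+ 2 = \sum_k x k 0 ^+ 2.
Proof.
rewrite /enorm mxE; under eq_bigr do rewrite mxE -expr2.
by rewrite sqr_sqrtr// sumr_ge0// => k _; exact: sqr_ge0.
Qed.

(** Distinctness of the constellation points enters here; it permits division by [bound j] in the
    gauge. *)
Let bound_gt0 j : j != i -> 0 < bound j.
Proof.
move=> ji; rewrite /bound mulr_gt0// lt0r sqr_ge0 andbT enorm_sqr.
apply: contra ji; rewrite psumr_eq0 => [/allP h|k _]; last exact: sqr_ge0.
apply/eqP/injs/eqP; rewrite -subr_eq0; apply/eqP/matrixP => k l.
rewrite (ord1 l) [RHS]mxE; apply/eqP; rewrite -sqrf_eq0.
exact: (h k (mem_index_enum _)).
Qed.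

Let innerE j y : inner j y = \sum_k (s j - s i) k 0 * tnth y k.
Proof. by rewrite /inner mxE; apply: eq_bigr => k _; rewrite !mxE. Qed.

Let inner_dilation j c y : inner j (dilation_tuple c y) = c * inner j y.
Proof.
rewrite !innerE mulr_sumr; apply: eq_bigr => k _.
by rewrite tnth_map mulrCA.
Qed.

Lemma region_gauge_ge0 y : 0 <= region_gauge y.
Proof. exact: bigmax_ge_id. Qed.

Lemma measurable_region_gauge : measurable_fun setT region_gauge.
Proof.
rewrite /region_gauge; elim: (index_enum _) => [|j r IH].
  by under eq_fun do rewrite big_nil; exact: measurable_cst.
have [ji|ji] := boolP (j != i); last first.
  by under eq_fun do rewrite big_cons (negPf ji).
under eq_fun do rewrite big_cons ji.
apply: measurable_maxr => //.
apply: measurable_funM => //.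
rewrite (_ : inner j = fun y => \sum_k (s j - s i) k 0 * tnth y k); last first.
  by apply/funext => y; exact: innerE.
apply: measurable_sum => k; apply: measurable_funM => //.
exact: measurable_tnth.
Qed.

Let region := @col_of_tuple R n @^-1` decision_region s i.

(** Each defining inequality is linear in the point, so dilation scales its left side by [c]. The
    initial value 0 of the maximum adds only the harmless [0 <= c^-1], and gives gauge 0 to rays
    that never leave the region. *)
Lemma region_dilationE (c : R) y : 0 <= c ->
  (region (dilation_tuple c y)) <-> c * region_gauge y <= 1.
Proof.
move=> c0; split => [h|h j ji].
  have [->|cN0] := eqVneq c 0; first by rewrite mul0r.
  have {}c0 : 0 < c by rewrite lt0r cN0.
  rewrite mulrC -ler_pdivlMr// mul1r; apply: bigmax_le.
    by rewrite invr_ge0 ltW.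
  move=> j ji; have := h j ji; rewrite -/(inner j _) -/(bound j) inner_dilation.
  by rewrite ler_pdivrMr ?bound_gt0// -ler_pdivrMl ?invr_gt0// invrK.
rewrite -/(inner j _) -/(bound j) inner_dilation.
rewrite -[leRHS]mul1r -ler_pdivrMr ?bound_gt0//.
apply: le_trans h; rewrite -mulrA ler_wpM2l//.
exact: (le_bigmax_cond _ (fun j => inner j y / bound j)).
Qed.

Lemma measurable_region : measurable region.
Proof.
rewrite (_ : region = setT `&` region_gauge @^-1` `]-oo, 1]).
  by apply: measurable_region_gauge => //; exact: measurable_itv.
rewrite setTI; apply/seteqP; split => y.
  move=> h; rewrite /= in_itv/= -[leLHS]mul1r; apply/(region_dilationE 1 y ler01).
  rewrite (_ : dilation_tuple 1 y = y)//.
  by apply: eq_from_tnth => k; rewrite tnth_map mul1r.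
rewrite /= in_itv/= -[leLHS]mul1r => /(region_dilationE 1 y ler01).
rewrite (_ : dilation_tuple 1 y = y)//.
by apply: eq_from_tnth => k; rewrite tnth_map mul1r.
Qed.

(* The ray through [y] leaves the decision region where [|x|^2 / (2 P)] reaches
   [(region_rate y * P)^-1], if [region_rate y] is positive; at [y = 0] the rate is 0. *)
Definition region_rate (y : n.-tuple mR) : R :=
  2 * region_gauge y ^+ 2 * sqnorm_tuple y `^ (-1).

Lemma region_rate_ge0 y : 0 <= region_rate y.
Proof. by rewrite !mulr_ge0 ?powR_ge0 ?exprn_ge0 ?region_gauge_ge0. Qed.

Lemma measurable_region_rate : measurable_fun setT region_rate.
Proof.
apply: measurable_funM.
  apply: measurable_funM => //; apply: measurable_funX.
  exact: measurable_region_gauge.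
exact: (measurableT_comp (@measurable_powR R (-1)) (measurable_sqnorm_tuple n)).
Qed.

(** The square of the condition in [region_dilationE], both sides of which are nonnegative. *)
Lemma region_rayE (P t : R) y : 0 < P -> 0 < t ->
  region (dilation_tuple ((2 * P * t * sqnorm_tuple y `^ (-1)) `^ 2^-1) y) <->
  t * (region_rate y * P) <= 1.
Proof.
move=> P0 t0.
set u := 2 * P * t * _.
have u0 : 0 <= u by rewrite !mulr_ge0 ?powR_ge0 ?(ltW P0) ?(ltW t0).
apply: (iff_trans (region_dilationE _ _ (powR_ge0 _ _))).
have -> : t * (region_rate y * P) = (u `^ 2^-1 * region_gauge y) ^+ 2.
  by rewrite exprMn powR_half_sqr// /u /region_rate; ring.
by rewrite expr_le1// mulr_ge0 ?powR_ge0 ?region_gauge_ge0.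
Qed.

Lemma noise_densityE (P : R) y :
  noise_density P (col_of_tuple y) = @gauss_density R n P y.
Proof.
rewrite /noise_density /gauss_density enorm_sqr /sqnorm_tuple.
by under eq_bigr do rewrite mxE.
Qed.

Let region_density_ge0 P y : 0 <= \1_region y * @gauss_density R n P y.
Proof. by rewrite mulr_ge0 ?gauss_density_ge0 ?indicE. Qed.

(** [Pc] is the real value of an extended integral, so finiteness has to be shown; the full
    Gaussian, of mass 1, dominates. *)
Let integral_region P : 0 < P ->
  (\int[mu]_y (\1_region y * @gauss_density R n P y)%:E = (Pc s i P)%:E)%E.
Proof.
move=> P0; rewrite /Pc /Rintegral.
rewrite [X in fine X](_ : _ =
    \int[mu]_y (\1_region y * @gauss_density R n P y)%:E)%E; last first.
  rewrite integral_mkcond; apply: eq_integral => y _.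
  by rewrite patchE indicE -noise_densityE; case: ifPn => _; rewrite ?mul1r ?mul0r.
rewrite fineK// ge0_fin_numE; last first.
  by apply: integral_ge0 => y _; rewrite lee_fin.
apply: (@le_lt_trans _ _ 1%E); last exact: ltry.
rewrite -(integral_gauss_density n P P0); apply: ge0_le_integral => //.
- by move=> y _; rewrite lee_fin.
- apply/measurable_EFinP; apply: measurable_funM; last exact: measurable_gauss_density.
  exact: (measurable_indic measurable_region).
- by apply/measurable_EFinP; exact: measurable_gauss_density.
- by move=> y _; rewrite lee_fin ler_piMl ?gauss_density_ge0// indicE lern1.
Qed.

Let integral_ray P y : 0 < P ->
  (\int[leb]_t (gauss_weight n y * (posind t * gamma_density a t *
    \1_region (dilation_tuple ((2 * P * t * sqnorm_tuple y `^ (-1)) `^ 2^-1) y)))%:E =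
    (gauss_weight n y * truncated_gamma a (region_rate y * P))%:E)%E.
Proof.
move=> P0; set v := region_rate y * P.
have mS := measurable_truncation v.
rewrite EFinM /truncated_gamma /Rintegral fineK; last first.
  apply: (@integrable_fin_num _ (measurableTypeR R)) => //.
  exact: (integrable_truncation a _ a0).
rewrite integral_mkcond -ge0_integralZl//; last 3 first.
- apply/(measurable_restrictT _ mS)/measurable_EFinP.
  exact: measurable_gamma_density.
- by move=> t _; rewrite patchE; case: ifP => _ //; rewrite lee_fin gamma_density_ge0.
- by rewrite lee_fin gauss_weight_ge0.
apply: eq_integral => t _; rewrite patchE.
have [t0|t0] := leP (t : R) 0.
  rewrite posindF// !mul0r mulr0 memNset ?mule0//= => -[].
  by rewrite in_itv/= andbT ltNge t0.
have rE := region_rayE P t y P0 t0; rewrite -/v in rE.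
have -> : \1_region (dilation_tuple ((2 * P * t * sqnorm_tuple y `^ (-1)) `^ 2^-1) y) =
    (t * v <= 1)%R%:R :> R.
  rewrite indicE; congr (_%:R); congr nat_of_bool; apply/idP/idP.
    by move=> /set_mem h; apply (proj1 rE).
  by move=> h; apply/mem_set; apply (proj2 rE).
have -> : (t \in `]0, +oo[%classic `&` [set t | t * v <= 1]) = (t * v <= 1).
  apply/idP/idP => [/set_mem[]//|tv]; apply/mem_set; split => //=.
  by rewrite in_itv/= t0.
rewrite posindT// mul1r; case: ifP => _; first by rewrite mulr1.
by rewrite !mulr0 mule0.
Qed.

(** Along each ray the region cuts the gamma integral at a threshold, which turns [radial_formula]
    into a mixture; then divide by [Gamma a], which is positive. *)
Lemma Pc_mixture (P : R) : 0 < P ->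
  Pc s i P = (Gamma a)^-1 * gamma_mixture mu (@gauss_weight R n) region_rate a P.
Proof.
move=> P0.
have := radial_formula n n0 region P measurable_region P0.
rewrite integral_region// radial_constE// -EFinM.
under eq_integral do rewrite integral_ray//.
move=> h; rewrite /gamma_mixture /Rintegral -h/= mulKf// gt_eqF// Gamma_gt0//.
Qed.

End region.

(** * The constants in terms of [n / 2], and the bounds on the error rate *)

Section error_rate.
Local Open Scope ring_scope.
Context {R : realType}.
Local Notation mR := (measurableTypeR R).

Lemma integrable_gauss_weight n :
  (lebesgue_Rn n).-integrable setT (EFin \o @gauss_weight R n).
Proof.
apply/integrableP; split.
  by apply/measurable_EFinP; exact: measurable_gauss_weight.
under eq_integral => y _ do rewrite /= ger0_norm ?gauss_weight_ge0//.
by rewrite integral_gauss_weight ltry.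
Qed.

Lemma sqrt_b_half n : Num.sqrt (2 * (n%:R + 2)) / 2 = Num.sqrt (n%:R / 2 + 1) :> R.
Proof.
have h : 0 <= n%:R / 2 + 1 :> R by rewrite addr_ge0 ?divr_ge0.
rewrite (_ : 2 * (n%:R + 2) = 2 ^+ 2 * (n%:R / 2 + 1)); last by field.
by rewrite sqrtrM ?sqr_ge0// sqrtr_sqr ger0_norm// mulrAC divff ?mul1r.
Qed.

Lemma b1E n : b1 n = n%:R / 2 + 1 + Num.sqrt (n%:R / 2 + 1) :> R.
Proof. by rewrite /b1 mulrDl sqrt_b_half; congr (_ + _); field. Qed.

Lemma b2E n : b2 n = n%:R / 2 + 1 - Num.sqrt (n%:R / 2 + 1) :> R.
Proof. by rewrite /b2 mulrBl sqrt_b_half; congr (_ - _); field. Qed.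

Lemma buE n : bu n = Num.sqrt (n%:R / 2 + 1) * gamma_peak (n%:R / 2) (b1 n) /
  Gamma (n%:R / 2) :> R.
Proof. by rewrite /bu /gamma_peak mulrDl divff// !mulrA. Qed.

Lemma blE n : bl n = - (Num.sqrt (n%:R / 2 + 1) * gamma_peak (n%:R / 2) (b2 n) /
  Gamma (n%:R / 2)) :> R.
Proof. by rewrite /bl /gamma_peak mulrDl divff// !mulrA. Qed.

End error_rate.

Theorem theorem9 (R : realType) (n M : nat) (s : 'I_M -> 'cV[R]_n)
    (p : 'I_M -> R) :
  (1 <= n)%N -> (2 <= M)%N -> constellation s -> priors p ->
  forall PN : R, 0 < PN ->
    [/\ derivable (Pe s p) PN 1,
        derivable (Pe s p)^`() PN 1,
        bl n / PN ^+ 2 <= (Pe s p)^`(2) PN &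
        (Pe s p)^`(2) PN <= bu n / PN ^+ 2].
Proof.
move=> n0 _ [injs _] [p0 p1] PN PN0.
pose a : R := (n%:R / 2)%R.
have a0 : (0 < a)%R by rewrite divr_gt0// ltr0n.
have G0 : (0 < Gamma a)%R := Gamma_gt0 a a0.
pose w := @gauss_weight R n.
pose z (i : 'I_M) := region_rate M n s i.
have w0 := gauss_weight_ge0 n : forall y, (0 <= w y)%R.
have intw : (lebesgue_Rn n).-integrable setT (EFin \o w) := integrable_gauss_weight n.
have w1 : (\int[lebesgue_Rn n]_y w y = 1)%R.
  by rewrite /Rintegral integral_gauss_weight.
have z0 i : forall y, (0 <= z i y)%R by move=> y; exact: region_rate_ge0.
have mz i : measurable_fun setT (z i) by exact: measurable_region_rate.
pose mix i := gamma_mixture (lebesgue_Rn n) w (z i) a.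
pose mix1 i := gamma_mixture1 (lebesgue_Rn n) w (z i) a.
pose mix2 i := gamma_mixture2 (lebesgue_Rn n) w (z i) a.
(* The minus sign comes from [Pei = 1 - Pc]; the ones add up to 1 because the priors do. *)
pose c i : R := (- p i / Gamma a)%R.
have PeE (Q : R) : (0 < Q)%R -> Pe s p Q = (1 + \sum_i c i * mix i Q)%R.
  move=> Q0; rewrite /Pe -p1 -big_split/=; apply: eq_bigr => i _.
  by rewrite /Pei (Pc_mixture M n s i injs n0)// /c -/a -/w -/(z i) -/(mix i) ; ring.
have d0 (Q : R) : (0 < Q)%R -> is_derive Q 1%R (Pe s p) (\sum_i c i * mix1 i Q)%R.
  move=> Q0.
  have h : is_derive Q 1%R (fun x : R => 1 + (\sum_i (fun x => c i * mix i x)) x)%R _ :=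
    is_deriveD (is_derive_cst (1%R : R) Q 1%R) (is_derive_sum (fun i =>
      is_deriveZ (c i) (is_derive_gamma_mixture _ w w0 intw _ (z0 i) (mz i) _ a0 Q Q0))).
  have {}h := is_derive_eq h (add0r _).
  (* The formula [PeE] holds for positive arguments only, and these fill a neighbourhood of [Q]. *)
  apply: near_eq_is_derive h; near=> x.
  by rewrite PeE ?fct_sumE//; near: x; exact: lt_nbhsr.
have d1E (Q : R) : (0 < Q)%R -> (Pe s p)^`() Q = (\sum_i c i * mix1 i Q)%R.
  by move=> Q0; rewrite derive1E; apply: (@derive_val _ _ _ _ _ _ _ (d0 _ Q0)).
have d1 : is_derive PN 1%R (Pe s p)^`() (\sum_i c i * mix2 i PN)%R.
  have h : is_derive PN 1%R (\sum_i (fun x => c i * mix1 i x))%R _ :=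
    is_derive_sum (fun i => is_deriveZ (c i)
      (is_derive_gamma_mixture1 _ w w0 intw _ (z0 i) (mz i) _ a0 PN PN0)).
  apply: near_eq_is_derive h; near=> x.
  by rewrite d1E ?fct_sumE//; near: x; exact: lt_nbhsr.
have d2E : (Pe s p)^`(2) PN = (\sum_i c i * mix2 i PN)%R.
  by rewrite derive1nS derive1n1 derive1E; apply: (@derive_val _ _ _ _ _ _ _ d1).
have bnd i := gamma_mixture2_bounds _ w w0 intw (z i) (z0 i) (mz i) a a0 PN PN0 w1.
split.
- exact: (@ex_derive _ _ _ _ _ _ _ (d0 _ PN0)).
- exact: (@ex_derive _ _ _ _ _ _ _ d1).
(* Since [c i <= 0], the upper bound of each mixture, attained at [b2], becomes the lower bound of
   the sum; the next case exchanges the roles, with [b1]. *)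
- rewrite d2E -[leLHS]mul1r -p1 mulr_suml; apply: ler_sum => i _.
  have /andP[_ ub] := bnd i.
  have -> : (p i * (bl n / PN ^+ 2) = c i * (Num.sqrt (a + 1) *
      gamma_peak a (a + 1 - Num.sqrt (a + 1)) / PN ^+ 2))%R.
    by rewrite /c blE b2E; field; rewrite !gt_eqF.
  by rewrite ler_wnM2l// /c mulNr oppr_le0 divr_ge0// ltW.
- rewrite d2E -[leRHS]mul1r -p1 mulr_suml; apply: ler_sum => i _.
  have /andP[lb _] := bnd i.
  have -> : (p i * (bu n / PN ^+ 2) = c i * (- (Num.sqrt (a + 1) *
      gamma_peak a (a + 1 + Num.sqrt (a + 1))) / PN ^+ 2))%R.
    by rewrite /c buE b1E; field; rewrite !gt_eqF.
  by rewrite ler_wnM2l// /c mulNr oppr_le0 divr_ge0// ltW.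
Unshelve. all: end_near. Qed.
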